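(* Every high Turing degree contains a Schnorr random set $Z$ such that $Z\leq_T R\cap Z$ for every infinite recursively enumerable set $R$. In particular, if $R$ is an infinite recursive set then $Z\equiv_T R\cap Z$.
   Context: A Turing degree $\mathbf a$ is high if $\mathbf a'\ge\mathbf 0''$. A Schnorr test is a uniformly c.e. sequence $(G_m)$ of open subsets of $2^\omega$ with $\mu(G_m)=2^{-m}$ for all $m$ ($\mu$ the uniform measure); $Z$ is Schnorr random if $Z\notin\bigcap_m G_m$ for every Schnorr test. *)

(* Defs.v *)
From HB Require Import structures.
From Stdlib Require Cantor.
From mathcomp Require Import all_boot all_order all_algebra.
From mathcomp Require Import zify.
From mathcomp Require Import all_classical all_reals all_analysis.

Set Implicit Arguments.
Unset Strict Implicit.
Unset Printing Implicit Defensive.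

Import Order.TTheory GRing.Theory Num.Theory.

Local Open Scope classical_set_scope.

(* Subsets of omega are identified with their characteristic functions, that
   is, with the points of 2^omega. *)
Notation natset := (nat -> bool).

Definition natset0 : natset := fun=> false.
Definition natsetI (A B : natset) : natset := fun n => A n && B n.

(** * Partial recursive functions with an oracle *)

(* The Cantor pairing, a bijection between nat * nat and nat. *)
Definition npair (a b : nat) : nat := Cantor.to_nat (a, b).

(* All functions are unary; several arguments are passed as one number through
   [npair]. *)
Inductive prog : Type :=
| PZero
| PSucc
| PLeft
| PRight
| POracle
| PPair of prog & prog
| PComp of prog & prog
| PRec of prog & prog
| PMin of prog.

(* [eval A p n v] means that [p], run on input n with oracle A, halts with
   output v. *)
Inductive eval (A : natset) : prog -> nat -> nat -> Prop :=
| eval_zero n : eval A PZero n 0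
| eval_succ n : eval A PSucc n n.+1
| eval_left a b : eval A PLeft (npair a b) a
| eval_right a b : eval A PRight (npair a b) b
| eval_oracle n : eval A POracle n (A n)
| eval_pair p q n a b :
    eval A p n a -> eval A q n b -> eval A (PPair p q) n (npair a b)
| eval_comp p q n a b :
    eval A q n a -> eval A p a b -> eval A (PComp p q) n b
| eval_rec0 p q a b :
    eval A p a b -> eval A (PRec p q) (npair a 0) b
| eval_recS p q a k b c :
    eval A (PRec p q) (npair a k) b -> eval A q (npair a (npair k b)) c ->
    eval A (PRec p q) (npair a k.+1) c
  (* the values f k.+1 witness that p converges to a nonzero value on all
     smaller candidates *)
| eval_min p a n (f : nat -> nat) :
    eval A p (npair a n) 0 ->
    (forall k, (k < n)%N -> eval A p (npair a k) (f k).+1) ->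
    eval A (PMin p) a n.

(* A Goedel numbering of programs: injective, with recursive range. *)
Fixpoint prog_code (p : prog) : nat :=
  match p with
  | PZero => npair 0 0
  | PSucc => npair 1 0
  | PLeft => npair 2 0
  | PRight => npair 3 0
  | POracle => npair 4 0
  | PPair p q => npair 5 (npair (prog_code p) (prog_code q))
  | PComp p q => npair 6 (npair (prog_code p) (prog_code q))
  | PRec p q => npair 7 (npair (prog_code p) (prog_code q))
  | PMin p => npair 8 (prog_code p)
  end.

(* A bijective coding of binary strings by numbers. *)
Fixpoint string_code (s : seq bool) : nat :=
  if s is b :: s' then ((string_code s').*2 + b).+1 else 0.

(** * Turing reducibility, jump, degrees *)

Definition turing_le (A B : natset) : Prop :=
  exists p, forall n, eval B p n (A n).

Definition turing_equiv (A B : natset) : Prop :=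
  turing_le A B /\ turing_le B A.

Definition recursive (A : natset) : Prop :=
  exists p, forall n, eval natset0 p n (A n).

Definition rec_enumerable (A : natset) : Prop :=
  exists p, forall n, A n <-> exists v, eval natset0 p n v.

(* The set of all e such that the e-th functional with oracle A halts on input
   e; a number that is not the code of a program indexes the nowhere defined
   functional. *)
Definition jump (A : natset) : natset :=
  fun e => `[< exists p v, prog_code p = e /\ eval A p e v >].

Definition deg (A : natset) : set natset := [set B | turing_equiv B A].

Definition turing_degree (a : set natset) : Prop := exists A, a = deg A.

(* The degree of the jump of any representative of a, for a degree a. *)
Definition deg_jump (a : set natset) : set natset :=
  [set B | exists2 A, a A & turing_equiv B (jump A)].

Definition deg_le (a b : set natset) : Prop :=
  exists A B, [/\ a A, b B & turing_le A B].

Definition high (a : set natset) : Prop :=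
  deg_le (deg_jump (deg_jump (deg natset0))) (deg_jump a).

(** * The uniform measure on Cantor space *)

Definition prefix_of (s : seq bool) (X : natset) : Prop :=
  forall i, (i < size s)%N -> nth false s i = X i.

Definition cylinder (s : seq bool) : set natset := [set X | prefix_of s X].

(* Cantor space with its Borel sigma-algebra. *)
Definition cantorType := g_sigma_algebraType (range cylinder).

Local Open Scope ring_scope.

Section uniform_measure.
Context {R : realType}.

Definition binary_digits (x : measurableTypeR R) : cantorType :=
  fun i => odd (Num.truncn (x * 2 ^+ i.+1)).

Let digit_measurable i : measurable [set x | binary_digits x i].
Proof.
rewrite (_ : [set _ | _] = \bigcup_(k in [set k | odd k])
   `[k%:R / 2 ^+ i.+1, k.+1%:R / 2 ^+ i.+1[%classic); last first.
  have e0 : 0 < 2 ^+ i.+1 :> R by rewrite exprn_gt0.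
  apply/seteqP; split => x /=.
  - rewrite /binary_digits => ox; exists (Num.truncn (x * 2 ^+ i.+1)) => //=.
    have x0 : 0 <= x * 2 ^+ i.+1.
      case: leP ox => // /ltW x0.
      by rewrite (_ : Num.truncn _ = 0%N)//; apply/truncn0Pn;
        rewrite -ltNge (le_lt_trans x0).
    by rewrite in_itv/= ler_pdivrMr// ltr_pdivlMr//; exact: truncn_itv.
  - case=> k /= ok; rewrite in_itv/= ler_pdivrMr// ltr_pdivlMr// => /truncn_def.
    by rewrite /binary_digits => ->.
apply: bigcup_measurable => k _; exact: measurable_itv.
Qed.

Let cylinder_measurable s : measurable (binary_digits @^-1` cylinder s).
Proof.
rewrite (_ : _ @^-1` _ = \bigcap_(i in `I_(size s))
    (if nth false s i then [set x | binary_digits x i]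
     else ~` [set x | binary_digits x i])); last first.
  apply/seteqP; split => x /= h i /= si; have := h i si;
    by case: nth => /= ; case: (binary_digits x i).
apply: bigcap_measurableType => i _; case: ifP => _ //.
exact: measurableC.
Qed.

Lemma measurable_binary_digits : measurable_fun setT binary_digits.
Proof.
apply: (@measurability _ _ _ cantorType _ _ (range cylinder)) => // _ [_ [s _ <-] <-].
by rewrite setTI.
Qed.

HB.instance Definition _ :=
  isMeasurableFun.Build _ _ _ _ binary_digits measurable_binary_digits.

(* The law of the binary digits of a uniformly distributed real of [0, 1]; it
   is the product of the fair coin measures, see [uniform_measure_cylinder]. *)
Definition uniform_measure : probability cantorType R :=
  distribution (uniform_prob (@ltr01 R)) binary_digits.

Lemma uniform_measure_cylinder s :
  uniform_measure (cylinder s) = (2 ^- size s)%:E.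
Proof.
pose val s := foldl (fun v (b : bool) => (v.*2 + b)%N) 0%N s.
have trunc_half (x : R) n : 0 <= x ->
    Num.truncn (x * 2 ^+ n) = (Num.truncn (x * 2 ^+ n.+1))./2.
  move=> x0; set t := Num.truncn (x * 2 ^+ n.+1).
  have /truncn_itv/andP[] : 0 <= x * 2 ^+ n.+1 by rewrite mulr_ge0// exprn_ge0.
  rewrite -/t exprSr mulrA => t1 t2; apply: truncn_def.
  have t1' : t./2.*2%:R <= x * 2 ^+ n * 2.
    by apply: le_trans t1; rewrite ler_nat -[leqRHS]odd_double_half leq_addl.
  have t2' : x * 2 ^+ n * 2 < t./2.+1.*2%:R.
    apply: lt_le_trans t2 _; rewrite ler_nat -[in leqLHS](odd_double_half t).
    by rewrite doubleS -addn1; case: odd; lia.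
  rewrite -!muln2 !natrM in t1' t2'.
  by rewrite -(ler_pM2r (ltr0n R 2)) t1'/= -(ltr_pM2r (ltr0n R 2)).
have valP (x : R) : 0 <= x < 1 ->
    prefix_of s (binary_digits x) <-> Num.truncn (x * 2 ^+ size s) = val s.
  move=> /andP[x0 x1]; elim/last_ind: s => [|s b IH].
    rewrite /val/= expr0 mulr1; split=> // _.
    by apply/truncn0Pn; rewrite -ltNge.
  have -> : val (rcons s b) = ((val s).*2 + b)%N.
    by rewrite /val -cats1 foldl_cat.
  have -> : prefix_of (rcons s b) (binary_digits x) <->
      prefix_of s (binary_digits x) /\ b = binary_digits x (size s).
    split=> [h|[h1 h2] i].
      split=> [i si|]; last by rewrite -h ?size_rcons// nth_rcons ltnn eqxx.
      by rewrite -h ?size_rcons 1?ltnW// nth_rcons si.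
    rewrite size_rcons ltnS leq_eqVlt => /predU1P[->|si].
      by rewrite nth_rcons ltnn eqxx.
    by rewrite nth_rcons si h1.
  rewrite IH trunc_half// size_rcons /binary_digits.
  move: (Num.truncn _) => t; split=> [[<- ->]|->].
    by rewrite addnC odd_double_half.
  by rewrite halfD doubleK odd_double oddD odd_double oddb; case: b; rewrite /= ?addn0.
have e0 : 0 < 2 ^+ size s :> R by rewrite exprn_gt0.
have val_lt : (val s < 2 ^ size s)%N.
  elim/last_ind: (s) => // s' b; rewrite /val -cats1 foldl_cat /= size_cat addn1.
  by rewrite expnS; case: b; lia.
pose I : set R := `[(val s)%:R / 2 ^+ size s, (val s).+1%:R / 2 ^+ size s[%classic.
have cylI : (binary_digits @^-1` cylinder s) `&` `[0, 1[ = I.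
  rewrite /I; apply/seteqP; split => x /=.
    rewrite !in_itv/= => -[/[swap] x01 /(valP _ x01) <-].
    rewrite ler_pdivrMr// ltr_pdivlMr//; apply: truncn_itv.
    by case/andP: x01 => x0 _; rewrite mulr_ge0// ltW.
  rewrite !in_itv/= ler_pdivrMr// ltr_pdivlMr// => /[dup] /andP[x0 x1] xs.
  have x01 : 0 <= x < 1.
    rewrite -(pmulr_lge0 _ e0) (le_trans _ x0)//= -(ltr_pM2r e0) mul1r.
    by rewrite (lt_le_trans x1)// -natrX ler_nat.
  by split=> //; apply/valP => //; exact: truncn_def.
have mI : measurable I by exact: measurable_itv.
rewrite /uniform_measure /distribution /pushforward/=.
set A := _ @^-1` _; have mA : measurable A := cylinder_measurable s.
rewrite /uniform_prob integral_uniform_pdf.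
have -> : A `&` `[0, 1] = I `|` (A `&` [set 1]).
  rewrite -cylI -setIUr; congr (_ `&` _); apply/seteqP; split=> x /=;
    rewrite !in_itv/=; last first.
    by move=> [/andP[-> /ltW->]//|->]; rewrite ler01 lexx.
  by rewrite (le_eqVlt x) => /andP[-> /predU1P[->|->]]; [right|left].
rewrite (eq_integral (cst 1%E)); last first.
  move=> x; rewrite inE => IAx; rewrite /uniform_pdf subr0 invr1.
  suff -> : 0 <= x <= 1 by [].
  case: IAx => [|[_ /= ->]]; last by rewrite ler01 lexx.
  by rewrite -cylI => -[_]/=; rewrite in_itv/= => /andP[-> /ltW].
have mA1 : measurable (A `&` [set 1]) by exact: measurableI.
rewrite integral_cst/= ?mul1e; last exact: measurableU.
rewrite measureU0//; last first.
  apply: (subset_measure0 mA1 (measurable_set1 1) (@subIsetr _ _ _)).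
  exact: lebesgue_measure_set1.
rewrite /= /I lebesgue_measure_itv/= lte_fin ltr_pM2r ?invr_gt0// ltr_nat ltnSn.
by rewrite -EFinD -mulrBl -natr1 addrAC subrr add0r mul1r.
Qed.

End uniform_measure.

(** * Schnorr randomness *)

(* Uniformly c.e. open sets: one program semidecides, given m and s, the
   relation "s belongs to the set of strings generating G m". *)
Definition uniformly_ce_open (G : nat -> set natset) : Prop :=
  exists p, forall m, G m =
    \bigcup_(s in [set s | exists v,
      eval natset0 p (npair m (string_code s)) v]) cylinder s.

Definition schnorr_test (R : realType) (G : nat -> set natset) : Prop :=
  uniformly_ce_open G /\
  forall m, @uniform_measure R (G m) = (2 ^- m)%:E.

Definition schnorr_random (R : realType) (Z : natset) : Prop :=
  forall G, schnorr_test R G -> ~ (\bigcap_m G m) Z.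

(* Main.v *)
(* If a is high, totality of programs is Sigma_2 in some A of degree a: there is
   an A-c.e. N such that N e n holds for all n when the program e is not total
   on its intended inputs, and fails for almost all n when it is.  Hence,
   dovetailing a run of e with the enumeration of N e n, A can decide at stage n
   to wait for e or to give up on it, and gives up on a total e only finitely often.

   Z is built in blocks [u n, u n.+1).  The word placed in a block transmits
   n + 3 bits: the bit A n and one bit per program e <= n.+1 telling whether
   e is waited for.  The outputs of the programs that are waited for fix the end
   of a later block, a finite set of positions and a clopen set of small
   measure.  The admissible words are taken from a code book: they avoid
   the clopen sets, and distinct words differ on each of the given sets of
   positions.  A counting argument shows that a code book exists, so a computable
   search finds one.

   For an infinite c.e. set R some program lists finite subsets of R, so almost
   every word, hence Z and A, can be decoded from R /\ Z.  For a Schnorr test the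
   computable measures yield a program producing clopen sets that would contain Z
   infinitely often if Z failed the test. *)
Require Import Defs.
From Stdlib Require Cantor.
From mathcomp Require Import all_boot all_order all_algebra.
From mathcomp Require Import zify.
From mathcomp Require Import all_classical all_reals all_analysis.
(* mathcomp-analysis has another [eval]. *)
Import Defs.

Set Implicit Arguments.
Unset Strict Implicit.
Unset Printing Implicit Defensive.

(** The decoder cannot consult A, hence not N either: this is why the message itself names the
    programs that halt. The decoder tries all messages in parallel, so a wrong one that waits
    forever does no harm.

    Let u < v be consecutive block ends. The clopen set computed from them has measure at most
    2^-(3u), a bound in the earlier end only, since what a Schnorr test gains between its stages at
    u and at v is small only in terms of u. Once the first v bits of Z are fixed this bound may say
    nothing. So each set is treated twice: the word of the block [u, v) keeps it thin relative to
    the prefix, and the next word avoids it. In the exponent 3u, one u pays for conditioning on the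
    u bits fixed before, the other two for Markov's inequality, as n + 5 <= u at stage n.

    The set of positions has at least 2v elements in the block that starts at v. Two random words
    agree there with probability at most 2^-(2v), which outweighs the 2^(n+3) messages of a
    stage. *)

Definition left z := (Cantor.of_nat z).1.
Definition right z := (Cantor.of_nat z).2.

Lemma left_pair a b : left (npair a b) = a.
Proof. by rewrite /left /npair Cantor.cancel_of_to. Qed.

Lemma right_pair a b : right (npair a b) = b.
Proof. by rewrite /right /npair Cantor.cancel_of_to. Qed.

Lemma npairK z : npair (left z) (right z) = z.
Proof. by rewrite /left /right /npair -surjective_pairing; exact: Cantor.cancel_to_of. Qed.

Lemma leq_npair a b : a + b <= npair a b.
Proof. by apply/leP; rewrite addnC; apply: Cantor.to_nat_non_decreasing. Qed.

Lemma npair_inj a b c d : npair a b = npair c d -> a = c /\ b = d.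
Proof.
by move=> h; split; [rewrite -(left_pair a b) h left_pair|rewrite -(right_pair a b) h right_pair].
Qed.

Opaque npair left right.

Definition pairE := (left_pair, right_pair).

Lemma eval_fun A p n v w : eval A p n v -> eval A p n w -> v = w.
Proof.
move=> h; elim: h w => {p n v}.
- by move=> n w h; inversion h.
- by move=> n w h; inversion h.
- by move=> a b w h; inversion h; subst; case: (npair_inj H).
- by move=> a b w h; inversion h; subst; case: (npair_inj H).
- by move=> n w h; inversion h.
- by move=> p q n a b _ iha _ ihb w h; inversion h; subst; rewrite (iha _ H1) (ihb _ H4).
- by move=> p q n a b _ iha _ ihb w h; inversion h; subst; apply: ihb; rewrite (iha _ H1).
- move=> p q a b _ ih w; move E : (npair a 0) => z h; inversion h; subst.
    match goal with H : npair _ _ = npair _ _ |- _ => case: (npair_inj H) => e _ end.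
    by apply: ih; rewrite -e.
  by match goal with H : npair _ _ = npair _ _ |- _ => case: (npair_inj H) end.
- move=> p q a k b c _ ih1 _ ih2 w; move E : (npair a k.+1) => z h; inversion h; subst.
    by match goal with H : npair _ _ = npair _ _ |- _ => case: (npair_inj H) end.
  match goal with H : npair _ _ = npair _ _ |- _ => case: (npair_inj H) => e [e2] end.
  by subst; apply: ih2; match goal with H : eval A (PRec p q) _ _ |- _ => rewrite (ih1 _ H) end.
- move=> p a n f _ ih0 _ ihf w h; inversion h; subst.
  case: (ltngtP n w) => // lt.
    by match goal with H : forall k, _ -> eval A p _ _ |- _ => have := ih0 _ (H _ lt) end.
  by match goal with H : eval A p _ 0 |- _ => have := ihf _ lt _ H end.
Qed.

(** * Computable functions *)

Definition computable_in A (f : nat -> nat) := exists p, forall n, eval A p n (f n).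

Lemma comp_ext A f g : f =1 g -> computable_in A f -> computable_in A g.
Proof. by move=> fg [p hp]; exists p => n; rewrite -fg. Qed.

Lemma comp_comp A f g : computable_in A f -> computable_in A g -> computable_in A (fun x => f (g x)).
Proof.
by move=> [p hp] [q hq]; exists (PComp p q) => n; apply: eval_comp (hq n) (hp _).
Qed.

Lemma comp_pair A f g : computable_in A f -> computable_in A g -> computable_in A (fun x => npair (f x) (g x)).
Proof. by move=> [p hp] [q hq]; exists (PPair p q) => n; apply: eval_pair. Qed.

Lemma eval_left' A z : eval A PLeft z (left z).
Proof. by rewrite -{1}(npairK z); apply: eval_left. Qed.

Lemma eval_right' A z : eval A PRight z (right z).
Proof. by rewrite -{1}(npairK z); apply: eval_right. Qed.

Lemma comp_left A f : computable_in A f -> computable_in A (fun x => left (f x)).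
Proof. by apply: comp_comp; exists PLeft => n; apply: eval_left'. Qed.

Lemma comp_right A f : computable_in A f -> computable_in A (fun x => right (f x)).
Proof. by apply: comp_comp; exists PRight => n; apply: eval_right'. Qed.

Lemma comp_id A : computable_in A (fun x => x).
Proof.
apply: (@comp_ext _ (fun x => npair (left x) (right x))); first exact: npairK.
by exists (PPair PLeft PRight) => n; apply: eval_pair; [apply: eval_left'|apply: eval_right'].
Qed.

Lemma comp_succ A f : computable_in A f -> computable_in A (fun x => (f x).+1).
Proof. by apply: (@comp_comp A S); exists PSucc => n; apply: eval_succ. Qed.

Fixpoint const_prog k := if k is k'.+1 then PComp PSucc (const_prog k') else PZero.

Lemma eval_const A k n : eval A (const_prog k) n k.
Proof.
elim: k => [|k ih] /=; first exact: eval_zero.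
by apply: eval_comp ih (eval_succ _ _).
Qed.

Lemma comp_const A k : computable_in A (fun=> k).
Proof. by exists (const_prog k) => n; apply: eval_const. Qed.

Lemma comp_oracle A f : computable_in A f -> computable_in A (fun x => A (f x) : nat).
Proof.
by apply: (@comp_comp A (fun x => A x : nat)); exists POracle => n; apply: eval_oracle.
Qed.

Lemma comp_rec A g h n : computable_in A g ->
  computable_in A (fun z => h (left z) (left (right z)) (right (right z))) -> computable_in A n ->
  computable_in A (fun x => nat_rect (fun _ => nat) (g x) (h x) (n x)).
Proof.
move=> [pg hg] [ph hh] hn.
pose F z := nat_rect (fun _ => nat) (g (left z)) (h (left z)) (right z).
apply: (@comp_ext _ (fun x => F (npair x (n x)))).
  by move=> x; rewrite /F !pairE.
apply: (@comp_comp A F); last by apply: comp_pair (comp_id _) hn.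
exists (PRec pg ph) => z; rewrite -(npairK z).
elim: (right z) => [|k ih].
  by rewrite /F !pairE /=; apply: eval_rec0.
apply: eval_recS ih _.
by have := hh (npair (left z) (npair k (F (npair (left z) k)))); rewrite /F !pairE.
Qed.

Lemma comp_add A f g : computable_in A f -> computable_in A g -> computable_in A (fun x => f x + g x).
Proof.
move=> hf hg; apply: (@comp_ext _ (fun x => nat_rect (fun _ => nat) (f x)
  ((fun x k r => r.+1) x) (g x))).
  by move=> x /=; elim: (g x) => [|k ih] /=; rewrite ?addn0 // ih addnS.
by apply: comp_rec => //; do 3?apply: comp_succ; do 2?apply: comp_right; apply: comp_id.
Qed.

Lemma comp_pred A f : computable_in A f -> computable_in A (fun x => (f x).-1).
Proof.
move=> hf; apply: (@comp_ext _ (fun x => nat_rect (fun _ => nat) 0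
  ((fun x k r => k) x) (f x))).
  by move=> x /=; elim: (f x) => [|k ih].
by apply: comp_rec; [exact: comp_const|apply: comp_left; apply: comp_right; exact: comp_id|].
Qed.

Lemma comp_sub A f g : computable_in A f -> computable_in A g -> computable_in A (fun x => f x - g x).
Proof.
move=> hf hg; apply: (@comp_ext _ (fun x => nat_rect (fun _ => nat) (f x)
  ((fun x k r => r.-1) x) (g x))).
  by move=> x /=; elim: (g x) => [|k ih] /=; rewrite ?subn0 // ih; lia.
by apply: comp_rec => //; apply: comp_pred; do 2?apply: comp_right; apply: comp_id.
Qed.

Lemma comp_mul A f g : computable_in A f -> computable_in A g -> computable_in A (fun x => f x * g x).
Proof.
move=> hf hg; apply: (@comp_ext _ (fun x => nat_rect (fun _ => nat) 0
  ((fun x k r => f x + r) x) (g x))).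
  by move=> x /=; elim: (g x) => [|k ih] /=; rewrite ?muln0 // ih mulnS.
apply: comp_rec => //; first exact: comp_const.
apply: comp_add; last by do 2?apply: comp_right; apply: comp_id.
by apply: comp_comp => //; apply: comp_left; apply: comp_id.
Qed.

Lemma comp_exp A f g : computable_in A f -> computable_in A g -> computable_in A (fun x => f x ^ g x).
Proof.
move=> hf hg; apply: (@comp_ext _ (fun x => nat_rect (fun _ => nat) 1
  ((fun x k r => f x * r) x) (g x))).
  by move=> x /=; elim: (g x) => [|k ih] /=; rewrite ?expn0 // ih expnS.
apply: comp_rec => //; first exact: comp_const.
apply: comp_mul; last by do 2?apply: comp_right; apply: comp_id.
by apply: comp_comp => //; apply: comp_left; apply: comp_id.
Qed.

Definition bsum n (f : nat -> nat) := \sum_(i < n) f i.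
Definition ball n (f : nat -> bool) := [forall i : 'I_n, f i].
Definition bex n (f : nat -> bool) := [exists i : 'I_n, f i].

Lemma comp_bsum A n (f : nat -> nat -> nat) : computable_in A n ->
  computable_in A (fun z => f (left z) (right z)) -> computable_in A (fun x => bsum (n x) (f x)).
Proof.
move=> hn hf; apply: (@comp_ext _ (fun x => nat_rect (fun _ => nat) 0
  ((fun x k r => r + f x k) x) (n x))).
  move=> x /=; rewrite /bsum; elim: (n x) => [|k ih] /=; first by rewrite big_ord0.
  by rewrite big_ord_recr /= ih.
apply: comp_rec => //; first exact: comp_const.
apply: comp_add; first by do 2?apply: comp_right; apply: comp_id.
apply: comp_ext (comp_comp (g := fun z => npair (left z) (left (right z))) hf _).
  by move=> z; rewrite !pairE.
apply: comp_pair; first by apply: comp_left; apply: comp_id.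
by apply: comp_left; apply: comp_right; apply: comp_id.
Qed.

Definition decidable_in A (P : nat -> bool) := computable_in A (fun x => P x : nat).

Lemma dec_leq A f g : computable_in A f -> computable_in A g -> decidable_in A (fun x => f x <= g x).
Proof.
move=> hf hg; apply: (@comp_ext _ (fun x => 1 - (f x - g x))).
  by move=> x; case: leqP => /=; lia.
by apply: comp_sub; [exact: comp_const|apply: comp_sub].
Qed.

Lemma dec_neg A P : decidable_in A P -> decidable_in A (fun x => ~~ P x).
Proof.
move=> hP; apply: (@comp_ext _ (fun x => 1 - P x)); first by move=> x; case: (P x).
by apply: comp_sub => //; apply: comp_const.
Qed.

Lemma dec_and A P Q : decidable_in A P -> decidable_in A Q -> decidable_in A (fun x => P x && Q x).
Proof.
move=> hP hQ; apply: (@comp_ext _ (fun x => P x * Q x)).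
  by move=> x; case: (P x); case: (Q x).
exact: comp_mul.
Qed.

Lemma dec_ext A P Q : P =1 Q -> decidable_in A P -> decidable_in A Q.
Proof. by move=> h; apply: comp_ext => x; rewrite h. Qed.

Lemma dec_or A P Q : decidable_in A P -> decidable_in A Q -> decidable_in A (fun x => P x || Q x).
Proof.
move=> hP hQ; apply: (@dec_ext _ (fun x => ~~ (~~ P x && ~~ Q x))).
  by move=> x; case: (P x); case: (Q x).
by apply: dec_neg; apply: dec_and; apply: dec_neg.
Qed.

Lemma dec_imp A P Q : decidable_in A P -> decidable_in A Q -> decidable_in A (fun x => P x ==> Q x).
Proof.
move=> hP hQ; apply: (@dec_ext _ (fun x => (~~ P x || Q x))).
  by move=> x; case: (P x); case: (Q x).
by apply: dec_or => //; apply: dec_neg.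
Qed.

Lemma dec_eq A f g : computable_in A f -> computable_in A g -> decidable_in A (fun x => f x == g x).
Proof.
move=> hf hg; apply: (@dec_ext _ (fun x => (f x <= g x) && (g x <= f x))).
  by move=> x; rewrite eqn_leq.
by apply: dec_and; apply: dec_leq.
Qed.

Lemma dec_eqb A P Q : decidable_in A P -> decidable_in A Q -> decidable_in A (fun x => P x == Q x).
Proof.
move=> hP hQ; apply: (@dec_ext _ (fun x => (P x : nat) == Q x)); last exact: dec_eq.
by move=> x; case: (P x); case: (Q x).
Qed.

Lemma dec_bex A n (f : nat -> nat -> bool) : computable_in A n ->
  decidable_in A (fun z => f (left z) (right z)) -> decidable_in A (fun x => bex (n x) (f x)).
Proof.
move=> hn hf.
apply: (@dec_ext _ (fun x => 0 < bsum (n x) (fun i => f x i))).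
  move=> x; apply/idP/idP.
    apply: contraTT; rewrite negb_exists => /forallP h.
    by rewrite -leqNgt leqn0 /bsum big1 // => i _; rewrite (negbTE (h i)).
  by move=> /existsP[i fi]; rewrite /bsum (bigD1 i) //= fi.
apply: dec_leq; first exact: comp_const.
by apply: (@comp_bsum A n (fun x i => f x i)).
Qed.

Lemma dec_ball A n (f : nat -> nat -> bool) : computable_in A n ->
  decidable_in A (fun z => f (left z) (right z)) -> decidable_in A (fun x => ball (n x) (f x)).
Proof.
move=> hn hf.
apply: (@dec_ext _ (fun x => ~~ bex (n x) (fun i => ~~ f x i))).
  move=> x; rewrite /bex /ball negb_exists.
  by apply: eq_forallb => i; rewrite negbK.
apply: dec_neg; apply: (@dec_bex A n (fun x i => ~~ f x i)) => //.
exact: dec_neg.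
Qed.

Lemma comp_bool A P : decidable_in A P -> computable_in A (fun x => P x : nat).
Proof. by []. Qed.

Lemma comp_if A P f g : decidable_in A P -> computable_in A f -> computable_in A g ->
  computable_in A (fun x => if P x then f x else g x).
Proof.
move=> hP hf hg; apply: (@comp_ext _ (fun x => P x * f x + (~~ P x) * g x)).
  by move=> x; case: (P x) => /=; rewrite ?mul1n ?mul0n ?addn0.
apply: comp_add; apply: comp_mul => //; exact: dec_neg.
Qed.

Lemma dec_odd A f : computable_in A f -> decidable_in A (fun x => odd (f x)).
Proof.
move=> hf; apply: (@comp_ext _ (fun x => nat_rect (fun _ => nat) 0
  ((fun x k r => 1 - r) x) (f x))).
  by move=> x /=; elim: (f x) => [|k ih] //=; rewrite ih; case: odd.
apply: comp_rec => //; first exact: comp_const.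
by apply: comp_sub; [exact: comp_const|do 2?apply: comp_right; apply: comp_id].
Qed.

Lemma dec_const A b : decidable_in A (fun=> b). Proof. exact: comp_const. Qed.

Lemma dec_comp A P f : decidable_in A P -> computable_in A f -> decidable_in A (fun x => P (f x)).
Proof. exact: (@comp_comp A (fun x => P x)). Qed.

(** The quotient counts the positive multiples of b up to a; the factor [0 < b] covers division by
    0, whose value is 0. *)
Lemma divn_bsum a b : a %/ b = (0 < b) * bsum a (fun i => i.+1 * b <= a).
Proof.
case: b => [|b]; first by rewrite divn0.
rewrite mul1n /bsum.
rewrite (eq_bigr (fun i : 'I_a => if (i : nat) < a %/ b.+1 then 1 else 0)); last first.
  by move=> i _; rewrite -leq_divRL //; case: leqP.
have le : a %/ b.+1 <= a by exact: leq_div.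
by rewrite -big_mkcond (big_ord_narrow le) sum1_card card_ord.
Qed.

Lemma comp_div A f g : computable_in A f -> computable_in A g -> computable_in A (fun x => f x %/ g x).
Proof.
move=> hf hg.
apply: (@comp_ext _ (fun x => (0 < g x) * bsum (f x) (fun i => i.+1 * g x <= f x))).
  by move=> x; rewrite -divn_bsum.
apply: comp_mul; first by apply: dec_leq => //; apply: comp_const.
apply: (@comp_bsum A f (fun x i => i.+1 * g x <= f x)) => //.
apply: dec_leq; first apply: comp_mul.
- by apply: comp_succ; apply: comp_right; apply: comp_id.
- by apply: comp_comp => //; apply: comp_left; apply: comp_id.
- by apply: comp_comp => //; apply: comp_left; apply: comp_id.
Qed.

Lemma comp_mod A f g : computable_in A f -> computable_in A g -> computable_in A (fun x => f x %% g x).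
Proof.
move=> hf hg; apply: (@comp_ext _ (fun x => f x - (f x %/ g x) * g x)).
  by move=> x; rewrite {1}(divn_eq (f x) (g x)) addKn.
by apply: comp_sub => //; apply: comp_mul => //; apply: comp_div.
Qed.

Definition bit w i := odd (w %/ 2 ^ i).

Lemma dec_bit A f g : computable_in A f -> computable_in A g -> decidable_in A (fun x => bit (f x) (g x)).
Proof.
by move=> hf hg; apply: dec_odd; apply: comp_div => //; apply: comp_exp => //; apply: comp_const.
Qed.

(** * Finite sequences coded by iterated pairing *)

Definition tl w i := iter i right w.
Definition sq w i := left (tl w i).

Lemma comp_tl A f g : computable_in A f -> computable_in A g -> computable_in A (fun x => tl (f x) (g x)).
Proof.
move=> hf hg; apply: (@comp_ext _ (fun x => nat_rect (fun _ => nat) (f x)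
  ((fun x k r => right r) x) (g x))).
  by move=> x /=; rewrite /tl; elim: (g x) => [|k ih] //=; rewrite ih.
by apply: comp_rec => //; do 3?apply: comp_right; apply: comp_id.
Qed.

Lemma comp_sq A f g : computable_in A f -> computable_in A g -> computable_in A (fun x => sq (f x) (g x)).
Proof. by move=> hf hg; apply: comp_left; apply: comp_tl. Qed.

(** The condition [tl w n = 0] makes the code canonical: by [sq_inj], a sequence of length n has
    only one code with this tail. *)
Lemma sq_exists n f : exists w, tl w n = 0 /\ forall i, i < n -> sq w i = f i.
Proof.
elim: n f => [|n ih] f; first by exists 0.
have [w [w0 hw]] := ih (fun i => f i.+1).
exists (npair (f 0) w); split; first by rewrite /tl iterSr right_pair.
by case=> [|i] ilt; rewrite /sq /tl ?pairE // iterSr right_pair -hw.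
Qed.

Lemma sq_inj n w w' : tl w n = tl w' n -> (forall i, i < n -> sq w i = sq w' i) -> w = w'.
Proof.
elim: n w w' => [//|n ih] w w'; rewrite /tl !iterSr => h hi.
rewrite -(npairK w) -(npairK w'); congr npair; first exact: (hi 0).
by apply: ih => // i lt; have := hi i.+1 lt; rewrite /sq /tl !iterSr.
Qed.

Lemma right_le z : right z <= z.
Proof. by rewrite -{2}(npairK z); have := leq_npair (left z) (right z); lia. Qed.

Lemma left_le z : left z <= z.
Proof. by rewrite -{2}(npairK z); have := leq_npair (left z) (right z); lia. Qed.

(** A code bounds every datum that it lists; a block end beyond the code is therefore large enough
    for all of them. *)
Lemma sq_le w i : sq w i <= w.
Proof.
apply: leq_trans (left_le _) _; rewrite /tl; elim: i => [//|i ih].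
by rewrite iterS; apply: leq_trans (right_le _) ih.
Qed.

Lemma sq0 i : sq 0 i = 0.
Proof. by have := sq_le 0 i; rewrite leqn0 => /eqP. Qed.

Opaque bit tl sq bsum ball bex.
Ltac computability_step :=
  lazymatch goal with
  | |- computable_in _ (fun x => x) => apply: comp_id
  | |- computable_in _ (fun x => nat_of_bool _) => apply: comp_bool
  | |- computable_in _ (fun x => _.+1) => apply: comp_succ
  | |- computable_in _ (fun x => _.-1) => apply: comp_pred
  | |- computable_in _ (fun x => addn _ _) => apply: comp_add
  | |- computable_in _ (fun x => subn _ _) => apply: comp_sub
  | |- computable_in _ (fun x => muln _ _) => apply: comp_mul
  | |- computable_in _ (fun x => expn _ _) => apply: comp_exp
  | |- computable_in _ (fun x => divn _ _) => apply: comp_div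
  | |- computable_in _ (fun x => modn _ _) => apply: comp_mod
  | |- computable_in _ (fun x => npair _ _) => apply: comp_pair
  | |- computable_in _ (fun x => left _) => apply: comp_left
  | |- computable_in _ (fun x => right _) => apply: comp_right
  | |- computable_in _ (fun x => sq _ _) => apply: comp_sq
  | |- computable_in _ (fun x => tl _ _) => apply: comp_tl
  | |- computable_in _ (fun x => bsum (@?n x) (@?f x)) => apply: (@comp_bsum _ n f)
  | |- computable_in _ (fun x => if _ then _ else _) => apply: comp_if
  | |- decidable_in _ (fun x => leq _ _) => apply: dec_leq
  | |- decidable_in _ (fun x => @eq_op bool _ _) => apply: dec_eqb
  | |- decidable_in _ (fun x => eq_op _ _) => first [apply: dec_eq | apply: dec_eqb]
  | |- decidable_in _ (fun x => ~~ _) => apply: dec_neg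
  | |- decidable_in _ (fun x => _ && _) => apply: dec_and
  | |- decidable_in _ (fun x => _ || _) => apply: dec_or
  | |- decidable_in _ (fun x => _ ==> _) => apply: dec_imp
  | |- decidable_in _ (fun x => bit _ _) => apply: dec_bit
  | |- decidable_in _ (fun x => odd _) => apply: dec_odd
  | |- decidable_in _ (fun x => ball (@?n x) (@?f x)) => apply: (@dec_ball _ n f)
  | |- decidable_in _ (fun x => bex (@?n x) (@?f x)) => apply: (@dec_bex _ n f)
  | H : decidable_in ?A ?P |- decidable_in ?A (fun x => ?P _) => apply: (dec_comp H)
  | H : forall A, decidable_in A ?P |- decidable_in _ (fun x => ?P _) => apply: (dec_comp (H _))
  | H : computable_in ?A ?f |- computable_in ?A (fun x => ?f _) => apply: (comp_comp H)
  | H : forall A, computable_in A ?f |- computable_in _ (fun x => ?f _) => apply: (comp_comp (H _))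
  | |- decidable_in ?A (fun x => ?A _) => apply: comp_oracle
  | |- computable_in _ left => exact: (comp_left (comp_id _))
  | |- computable_in _ right => exact: (comp_right (comp_id _))
  | H : computable_in ?A ?f |- computable_in ?A ?f => exact: H
  | H : forall A, computable_in A ?f |- computable_in _ ?f => exact: H
  | H : decidable_in ?A ?f |- decidable_in ?A ?f => exact: H
  | H : forall A, decidable_in A ?f |- decidable_in _ ?f => exact: H
  | |- computable_in _ (fun x => _) => apply: comp_const
  | |- decidable_in _ (fun x => _) => apply: dec_const
  | |- computable_in ?A ?f => change (computable_in A (fun x => f x))
  | |- decidable_in ?A ?f => change (decidable_in A (fun x => f x))
  end; cbv beta.
Ltac computability := repeat computability_step.

(** * Enumerable predicates *)

Section enumerable_in.
Variable A : natset.

(** Sigma_1 normal form: since q is total, a witness is found by minimisation. *)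
Definition enumerable_in (P : nat -> Prop) :=
  exists2 q, computable_in A q & forall x, P x <-> exists w, q (npair x w) = 0.

Lemma CE_ext (P Q : nat -> Prop) : (forall x, P x <-> Q x) -> enumerable_in P -> enumerable_in Q.
Proof. by move=> h [q cq hq]; exists q => // x; rewrite -h. Qed.

Lemma CE_dec (P : nat -> bool) : decidable_in A P -> enumerable_in P.
Proof.
move=> dP; exists (fun z => ~~ P (left z)); first by computability.
move=> x; split=> [Px|[w]]; first by exists 0; rewrite pairE Px.
by rewrite pairE; case: (P x).
Qed.

Lemma CE_and P Q : enumerable_in P -> enumerable_in Q -> enumerable_in (fun x => P x /\ Q x).
Proof.
move=> [p cp hp] [q cq hq].
exists (fun z => p (npair (left z) (left (right z))) + q (npair (left z) (right (right z)))).
  by computability.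
move=> x; rewrite hp hq; split=> [[[w hw] [w' hw']]|[w]].
  by exists (npair w w'); rewrite !pairE hw hw'.
by rewrite !pairE => /eqP; rewrite addn_eq0 => /andP[/eqP h1 /eqP h2]; split; eexists; eassumption.
Qed.

Lemma CE_or P Q : enumerable_in P -> enumerable_in Q -> enumerable_in (fun x => P x \/ Q x).
Proof.
move=> [p cp hp] [q cq hq].
exists (fun z => p z * q z); first by computability.
move=> x; rewrite hp hq; split=> [[[w hw]|[w hw]]|[w]].
- by exists w; rewrite hw.
- by exists w; rewrite hw muln0.
by move=> /eqP; rewrite muln_eq0 => /orP[/eqP h1|/eqP h1]; [left|right]; eexists; eassumption.
Qed.

Lemma CE_ex (P : nat -> nat -> Prop) : enumerable_in (fun z => P (left z) (right z)) ->
  enumerable_in (fun x => exists y, P x y).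
Proof.
move=> [q cq hq].
exists (fun z => q (npair (npair (left z) (left (right z))) (right (right z)))); first by computability.
move=> x; split=> [[y]|[w]].
  have := hq (npair x y); rewrite !pairE => -> [w hw].
  by exists (npair y w); rewrite !pairE.
rewrite !pairE => h; exists (left w); have := hq (npair x (left w)).
by rewrite !pairE => ->; eexists; eassumption.
Qed.

Lemma CE_all n (P : nat -> nat -> Prop) : computable_in A n -> enumerable_in (fun z => P (left z) (right z)) ->
  enumerable_in (fun x => forall y, y < n x -> P x y).
Proof.
move=> hn [q cq hq].
exists (fun z => ~~ ball (n (left z)) (fun y => q (npair (npair (left z) y) (sq (right z) y)) == 0)).
  by computability.
move=> x; split=> [h|[w]].
  have /choice[f hf] : forall y, exists w, y < n x -> q (npair (npair x y) w) = 0.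
    move=> y; have [lt|_] := ltnP y (n x); last by exists 0.
    have := hq (npair x y); rewrite !pairE => hqy.
    by have [w hw] := hqy.1 (h _ lt); exists w.
  have [w [_ hw]] := sq_exists (n x) f; exists w; rewrite !pairE.
  apply/eqP; rewrite eqb0 negbK; apply/forallP => y.
  by rewrite hw // hf.
rewrite !pairE => /eqP; rewrite eqb0 negbK => /forallP h y lt.
have := hq (npair x y); rewrite !pairE => ->; exists (sq w y).
by apply/eqP; exact: (h (Ordinal lt)).
Qed.

Lemma CE_comp (P : nat -> Prop) f : enumerable_in P -> computable_in A f -> enumerable_in (fun x => P (f x)).
Proof.
move=> [q cq hq] hf; exists (fun z => q (npair (f (left z)) (right z))); first by computability.
by move=> x; rewrite hq; split=> -[w hw]; exists w; move: hw; rewrite !pairE.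
Qed.

Lemma CE_comp2 (P : nat -> nat -> Prop) f g :
  enumerable_in (fun z => P (left z) (right z)) -> computable_in A f -> computable_in A g -> enumerable_in (fun x => P (f x) (g x)).
Proof.
move=> hP hf hg; apply: CE_ext (CE_comp (f := fun x => npair (f x) (g x)) hP _).
  by move=> x; rewrite !pairE.
exact: comp_pair.
Qed.

Lemma CE_eq f g : computable_in A f -> computable_in A g -> enumerable_in (fun x => f x = g x).
Proof.
move=> hf hg; apply: (@CE_ext (fun x => f x == g x)); last by apply: CE_dec; computability.
by move=> x; split=> /eqP.
Qed.

Lemma CE_imp f g (P : nat -> Prop) : computable_in A f -> computable_in A g -> enumerable_in P ->
  enumerable_in (fun x => f x = g x -> P x).
Proof.
move=> hf hg hP; apply: (@CE_ext (fun x => f x != g x \/ P x)).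
  by move=> x; split=> [[/eqP|]|h]//; case: eqP => e; [right; auto|left].
by apply: CE_or => //; apply: CE_dec; computability.
Qed.

(** Keep only the value given by the least witness. Applied to code books, this makes encoder and
    decoder settle on the same book. *)
Lemma CE_unif (P : nat -> nat -> Prop) : enumerable_in (fun z => P (left z) (right z)) ->
  exists Q : nat -> nat -> Prop,
  [/\ enumerable_in (fun z => Q (left z) (right z)), forall x y, Q x y -> P x y,
    forall x y y', Q x y -> Q x y' -> y = y' &
    forall x, (exists y, P x y) -> exists y, Q x y].
Proof.
move=> [q cq hq].
pose q' x w := q (npair (npair x (left w)) (right w)).
exists (fun x y => exists w, left w = y /\ ((q' x w == 0) && ball w (fun w' => q' x w' != 0))).
have qP x y : P x y <-> exists w, left w = y /\ q' x w = 0.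
  have := hq (npair x y); rewrite !pairE => ->; split=> -[w].
    by move=> h; exists (npair y w); rewrite /q' !pairE.
  by move=> [<- h]; exists (right w).
split.
- apply: (@CE_ex (fun z w => left w = right z /\ _)).
  apply: CE_and; first by apply: CE_eq; computability.
  by apply: CE_dec; rewrite /q'; computability.
- by move=> x y [w [e /andP[/eqP h _]]]; rewrite qP; exists w.
- move=> x y y' [w [<- /andP[h1 /forallP h2]]] [w' [<- /andP[h1' /forallP h2']]].
  case: (ltngtP w w') => [lt|lt|->//].
    by have := h2' (Ordinal lt); rewrite /= h1.
  by have := h2 (Ordinal lt); rewrite /= h1'.
- move=> x [y]; rewrite qP => -[w0 [_ h0]].
  have ex : exists w, q' x w == 0 by exists w0; apply/eqP.
  case: (ex_minnP ex) => w hw hmin; exists (left w), w; split=> //; rewrite hw /=.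
  apply/forallP => i; apply/negP => h.
  by have := hmin _ h; rewrite leqNgt ltn_ord.
Qed.

Lemma eval_PMin q p x : (forall z, eval A p z (q z)) ->
  (exists w, q (npair x w) = 0) -> exists2 w, q (npair x w) = 0 & eval A (PMin p) x w.
Proof.
move=> hp [w0 h0].
have ex : exists w, q (npair x w) == 0 by exists w0; apply/eqP.
case: (ex_minnP ex) => w /eqP hw hmin; exists w => //.
apply: (@eval_min _ _ _ _ (fun k => (q (npair x k)).-1)); first by rewrite -hw.
move=> k lt; have : q (npair x k) != 0.
  by apply/negP => h; have := hmin _ h; rewrite leqNgt lt.
by case E : (q _) => [//|m] _ /=; rewrite -E.
Qed.

(** The search runs over pairs of a value and a witness. It halts wherever a value exists, and P may
    have no value elsewhere. *)
Lemma CE_choice_prog (P : nat -> nat -> Prop) : enumerable_in (fun z => P (left z) (right z)) ->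
  exists p, forall x, (exists y, P x y) -> exists2 y, P x y & eval A p x y.
Proof.
move=> [q cq hq].
have [p hp] : computable_in A (fun z => q (npair (npair (left z) (left (right z))) (right (right z)))).
  by computability.
exists (PComp PLeft (PMin p)) => x [y].
have := hq (npair x y); rewrite !pairE => -> [w hw].
have [|w' hw' e'] := eval_PMin (x := x) hp.
  by exists (npair y w); rewrite !pairE.
exists (left w').
  have := hq (npair x (left w')); rewrite !pairE => ->; exists (right w').
  by rewrite !pairE in hw'.
by apply: eval_comp e' (eval_left' _ _).
Qed.

Lemma CE_domain (P : nat -> Prop) : enumerable_in P -> exists p, forall x, P x <-> exists v, eval A p x v.
Proof.
move=> [q [p hp] hq]; exists (PMin p) => x; rewrite hq; split=> [h|[v h]].
  by have [w _ h'] := eval_PMin hp h; exists w.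
inversion h; subst; exists v; exact: (eval_fun (hp _) H0).
Qed.

Lemma CE_choice (P : nat -> nat -> Prop) : enumerable_in (fun z => P (left z) (right z)) ->
  (forall x, exists y, P x y) -> exists2 f, computable_in A f & forall x, P x (f x).
Proof.
move=> /CE_choice_prog[p hp] h.
have /choice[f hf] : forall x, exists y, P x y /\ eval A p x y.
  by move=> x; have [y h1 h2] := hp x (h x); exists y.
by exists f => [|x]; [exists p => x|]; case: (hf x).
Qed.

End enumerable_in.

Ltac enumerability_step :=
  lazymatch goal with
  | |- enumerable_in _ (fun x => _ /\ _) => apply: CE_and
  | |- enumerable_in _ (fun x => and _ _) => apply: CE_and
  | |- enumerable_in _ (fun x => _ \/ _) => apply: CE_or
  | |- enumerable_in _ (fun x => exists y, @?P x y) => apply: (@CE_ex _ P)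
  | |- enumerable_in _ (fun x => forall y, is_true (leq (S y) (@?n x)) -> @?P x y) => apply: (@CE_all _ n P)
  | |- enumerable_in _ (fun x => @eq nat _ _ -> _) => apply: CE_imp
  | |- enumerable_in _ (fun x => is_true (@?P x)) => apply: (@CE_dec _ P)
  | |- enumerable_in _ (fun x => @eq nat _ _) => apply: CE_eq
  | H : enumerable_in ?A ?P |- enumerable_in ?A (fun x => ?P _) => apply: (CE_comp H)
  | H : forall A, enumerable_in A ?P |- enumerable_in _ (fun x => ?P _) => apply: (CE_comp (H _))
  | H : enumerable_in ?A (fun z => ?P (left z) (right z)) |- enumerable_in ?A (fun x => ?P _ _) =>
     apply: (@CE_comp2 _ P _ _ H)
  | H : forall A, enumerable_in A (fun z => ?P (left z) (right z)) |- enumerable_in ?A (fun x => ?P _ _) =>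
     apply: (@CE_comp2 _ P _ _ (H A))
  | _ => computability_step
  end; cbv beta.
Ltac enumerability := repeat enumerability_step.

(** * Enumerability of the evaluation relation *)

Definition fact e x v := npair e (npair x v).
Definition fcode f := left f.
Definition farg f := left (right f).
Definition fval f := right (right f).

(* One inference step of the inductive definition of [eval], the premises being
   taken in M; an oracle answer is left unconstrained. *)
Definition step (M : nat -> Prop) (e x v : nat) : Prop :=
  (e = npair 0 0 /\ v = 0) \/ (e = npair 1 0 /\ v = x.+1) \/
  (e = npair 2 0 /\ v = left x) \/ (e = npair 3 0 /\ v = right x) \/
  (e = npair 4 0 /\ v <= 1) \/
  (exists p q, e = npair 5 (npair p q) /\ M (fact p x (left v)) /\ M (fact q x (right v))) \/
  (exists p q a, e = npair 6 (npair p q) /\ M (fact q x a) /\ M (fact p a v)) \/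
  (exists p q, e = npair 7 (npair p q) /\
     ((right x = 0 /\ M (fact p (left x) v)) \/
      (exists k b, right x = k.+1 /\ M (fact e (npair (left x) k) b) /\
         M (fact q (npair (left x) (npair k b)) v)))) \/
  (exists p, e = npair 8 p /\ M (fact p (npair x v) 0) /\
     forall k, k < v -> exists b, M (fact p (npair x k) b.+1)).

Lemma step_mono (M M' : nat -> Prop) e x v :
  (forall f, M f -> M' f) -> step M e x v -> step M' e x v.
Proof.
move=> h; rewrite /step.
case=> [h1|]; first by left.
case=> [h1|]; first by right; left.
case=> [h1|]; first by do 2!right; left.
case=> [h1|]; first by do 3!right; left.
case=> [h1|]; first by do 4!right; left.
case=> [[p [q [e1 [e2 e3]]]]|]; first by do 5!right; left; exists p, q; auto.
case=> [[p [q [a [e1 [e2 e3]]]]]|]; first by do 6!right; left; exists p, q, a; auto.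
case=> [[p [q [e1 [[e2 e3]|[k [b [e2 [e3 e4]]]]]]]]|[p [e1 [e2 e3]]]].
- by do 7!right; left; exists p, q; split=> //; left; auto.
- by do 7!right; left; exists p, q; split=> //; right; exists k, b; auto.
- do 8!right; exists p; split=> //; split; first by auto.
  by move=> k lt; have [b hb] := e3 _ lt; exists b; auto.
Qed.

Definition code_step (M : nat -> Prop) (e : nat) : Prop :=
  (exists k, k < 5 /\ e = npair k 0) \/
  (exists k p q, 4 < k /\ k < 8 /\ e = npair k (npair p q) /\ M p /\ M q) \/
  (exists p, e = npair 8 p /\ M p).

Lemma code_step_mono (M M' : nat -> Prop) e :
  (forall f, M f -> M' f) -> code_step M e -> code_step M' e.
Proof.
move=> h [?|[[k [p [q [k5 [k8 [ee [mp mq]]]]]]]|[p [ee mp]]]]; first by left.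
- by right; left; exists k, p, q; auto 6.
- by do 2!right; exists p; auto.
Qed.

Section inductive_definition.
Variable S : (nat -> Prop) -> nat -> Prop.
Hypothesis S_mono : forall (M M' : nat -> Prop) f, (forall f, M f -> M' f) -> S M f -> S M' f.

(** A number d codes a length and that many entries, each obtained from earlier ones. Unlike an
    inductive predicate, this has the form of an enumerable condition. *)
Definition derivation d := forall i, i < left d ->
  S (fun f => exists j, j < i /\ sq (right d) j = f) (sq (right d) i).

Definition derives d f := derivation d /\ exists i, i < left d /\ sq (right d) i = f.

(** The same derivations as lists, which can be concatenated when a step has several premises. *)
Inductive derivation_seq : seq nat -> Prop :=
| dseq_nil : derivation_seq [::]
| dseq_rcons L f : derivation_seq L -> S (fun g => g \in L) f -> derivation_seq (rcons L f).

Lemma dseq_cat L1 L2 : derivation_seq L1 -> derivation_seq L2 -> derivation_seq (L1 ++ L2).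
Proof.
move=> h1 h2; elim: h2 => [|L f _ ih hf]; first by rewrite cats0.
rewrite -rcons_cat; apply: dseq_rcons => //; apply: S_mono hf => g.
by rewrite mem_cat orbC => ->.
Qed.

Lemma dseq_add L f : derivation_seq L -> S (fun g => g \in L) f ->
  exists2 L', derivation_seq L' & f \in L'.
Proof. by move=> h hf; exists (rcons L f); [exact: dseq_rcons|rewrite mem_rcons inE eqxx]. Qed.

Lemma dseq_derives L f : derivation_seq L -> f \in L -> exists d, derives d f.
Proof.
move=> hL fL; have [w [_ hw]] := sq_exists (size L) (nth 0 L).
exists (npair (size L) w); split; last first.
  by exists (index f L); rewrite !pairE index_mem fL hw ?index_mem // nth_index.
move=> i; rewrite !pairE => ilt.
apply: (@S_mono (fun g => exists j, j < i /\ nth 0 L j = g)).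
  by move=> g [j [ji <-]]; exists j; split=> //; apply: hw; apply: ltn_trans ilt.
rewrite hw //; clear hw fL; elim: hL i ilt => [//|L' g _ ih hg] i.
rewrite size_rcons nth_rcons ltnS leq_eqVlt => /predU1P[->|lt].
  rewrite ltnn eqxx; apply: S_mono hg => g' g'L; exists (index g' L').
  by rewrite index_mem nth_rcons index_mem g'L nth_index.
rewrite lt; apply: S_mono (ih _ lt) => g' [j [ji e]]; exists j; split=> //.
by rewrite nth_rcons (ltn_trans ji).
Qed.

Lemma derives_ind (P : nat -> Prop) : (forall f, S P f -> P f) ->
  forall d f, derives d f -> P f.
Proof.
move=> hP d f [dd [i [id <-]]]; elim/ltn_ind: i id => i ih id.
by apply: hP; apply: S_mono (dd _ id) => g [j [ji <-]]; apply: ih => //; apply: ltn_trans id.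
Qed.

End inductive_definition.

(** The oracle is a relation rather than a set, so that in [high_nontotal] some answers can be
    accepted without verification. *)
Definition fact_step (O : nat -> nat -> Prop) M f :=
  step M (fcode f) (farg f) (fval f) /\ (fcode f = npair 4 0 -> O (farg f) (fval f)).

Lemma fact_step_mono O (M M' : nat -> Prop) f :
  (forall f, M f -> M' f) -> fact_step O M f -> fact_step O M' f.
Proof. by move=> h [h1 h2]; split=> //; apply: step_mono h1. Qed.

Lemma prog_code_inj : injective prog_code.
Proof.
elim=> [|||||p ihp q ihq|p ihp q ihq|p ihp q ihq|p ihp] [|||||p' q'|p' q'|p' q'|p'] //=
  /npair_inj[] // _.
- by move=> /npair_inj[/ihp -> /ihq ->].
- by move=> /npair_inj[/ihp -> /ihq ->].
- by move=> /npair_inj[/ihp -> /ihq ->].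
- by move=> /ihp ->.
Qed.

Lemma is_codeP e : (exists d, derives code_step d e) <-> exists p, prog_code p = e.
Proof.
split=> [[d]|[p <-]].
  move=> h; apply: (derives_ind code_step_mono (P := fun e => exists p, prog_code p = e) _ h) => {h d}{}e.
  move=> [[k [k5 ->]]|[[k [p [q [k5 [k8 [-> [[p' <-] [q' <-]]]]]]]]|[p [-> [p' <-]]]]].
  - case: k k5 => [|[|[|[|[|]]]]] // _;
      [by exists PZero|by exists PSucc|by exists PLeft|by exists PRight|by exists POracle].
  - have : k = 5 \/ k = 6 \/ k = 7 by lia.
    by case=> [->|[->|->]]; [exists (PPair p' q')|exists (PComp p' q')|exists (PRec p' q')].
  - by exists (PMin p').
suff [L hL] : exists2 L, derivation_seq code_step L & prog_code p \in L.
  exact: (dseq_derives code_step_mono hL).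
have base k : k < 5 -> exists2 L, derivation_seq code_step L & npair k 0 \in L.
  move=> k5; exists (rcons [::] (npair k 0)); last by rewrite inE.
  by apply: dseq_rcons; [exact: dseq_nil|left; exists k].
have bin k p1 p2 : 4 < k -> k < 8 ->
   (exists2 L, derivation_seq code_step L & prog_code p1 \in L) ->
   (exists2 L, derivation_seq code_step L & prog_code p2 \in L) ->
   exists2 L, derivation_seq code_step L & npair k (npair (prog_code p1) (prog_code p2)) \in L.
  move=> k4 k8 [L1 h1 h1'] [L2 h2 h2'].
  apply: (@dseq_add _ (L1 ++ L2)); first exact: (dseq_cat code_step_mono).
  right; left; exists k, (prog_code p1), (prog_code p2).
  by rewrite !mem_cat h1' h2' orbT.
elim: p => /= [|||||p ihp q ihq|p ihp q ihq|p ihp q ihq|p [L h h']];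
  try exact: base; try exact: bin.
apply: (dseq_add h).
by do 2!right; exists (prog_code p).
Qed.

Lemma factE e x v : (fcode (fact e x v) = e) * (farg (fact e x v) = x) * (fval (fact e x v) = v).
Proof. by rewrite /fact /fcode /farg /fval !pairE. Qed.

Definition oracle (A : natset) y b := b = nat_of_bool (A y).

Lemma derives_sound (A : natset) d p x v :
  derives (fact_step (oracle A)) d (fact (prog_code p) x v) -> eval A p x v.
Proof.
move=> h; have := derives_ind (@fact_step_mono (oracle A))
  (P := fun f => forall p, prog_code p = fcode f -> eval A p (farg f) (fval f)) _ h.
rewrite !factE; apply=> {h d x v p}// f [st ok] P eP; move: st ok.
rewrite -eP; move: (farg f) (fval f) => x v {f eP}; rewrite /step.
case=> [[e ->] _|]; first by rewrite (@prog_code_inj P PZero e); constructor.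
case=> [[e ->] _|]; first by rewrite (@prog_code_inj P PSucc e); constructor.
case=> [[e ->] _|]; first by rewrite (@prog_code_inj P PLeft e); apply: eval_left'.
case=> [[e ->] _|]; first by rewrite (@prog_code_inj P PRight e); apply: eval_right'.
case=> [[e _] ok|].
  by rewrite (ok e) (@prog_code_inj P POracle e); constructor.
case=> [[p [q [e [h1 h2]]]] _|].
  move: h1 h2; rewrite !factE.
  case: P e => /= [|||||p' q'|p' q'|p' q'|p'] /npair_inj[] // _ /npair_inj[<- <-] h1 h2.
  by rewrite -(npairK v); constructor; auto.
case=> [[p [q [a [e [h1 h2]]]]] _|].
  move: h1 h2; rewrite !factE.
  case: P e => /= [|||||p' q'|p' q'|p' q'|p'] /npair_inj[] // _ /npair_inj[<- <-] h1 h2.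
  by econstructor; auto.
case=> [[p [q [e h]]] _|[p [e [h1 h2]]] _].
  case: P e h => /= [|||||p' q'|p' q'|p' q'|p'] /npair_inj[] // _ /npair_inj[<- <-].
  rewrite -[X in _ -> eval _ _ X _]npairK => -[[-> h]|[k [b [-> [h1 h2]]]]].
    by apply: eval_rec0; move: h; rewrite !factE; auto.
  move: h1 h2; rewrite !factE => h1 h2.
  by apply: eval_recS (h1 (PRec p' q') erefl) (h2 _ _).
move: h1 h2; rewrite !factE.
case: P e => /= [|||||p' q'|p' q'|p' q'|p'] /npair_inj[] // _ <- h1 h2.
have /choice[g hg] : forall k, exists b, k < v -> eval A p' (npair x k) b.+1.
  move=> k; have [kv|_] := ltnP k v; last by exists 0.
  by have [b] := h2 _ kv; rewrite !factE => h; exists b => _; apply: h.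
by apply: eval_min => //; auto.
Qed.

Lemma eval_dseq (A : natset) p x v : eval A p x v ->
  exists2 L, derivation_seq (fact_step (oracle A)) L & fact (prog_code p) x v \in L.
Proof.
have cat := dseq_cat (@fact_step_mono (oracle A)).
elim=> {p x v}.
- move=> n; apply: dseq_add (dseq_nil _) _; split; rewrite !factE /=; [by left|by case/npair_inj].
- move=> n; apply: dseq_add (dseq_nil _) _; split; rewrite !factE /=; [by right; left|by case/npair_inj].
- move=> a b; apply: dseq_add (dseq_nil _) _; split; rewrite !factE /=; [by do 2!right; left; rewrite pairE|by case/npair_inj].
- move=> a b; apply: dseq_add (dseq_nil _) _; split; rewrite !factE /=; [by do 3!right; left; rewrite pairE|by case/npair_inj].
- move=> n; apply: dseq_add (dseq_nil _) _; split; rewrite !factE //.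
  by do 4!right; left; split=> //; case: (A n).
- move=> p q n a b _ [L1 h1 h1'] _ [L2 h2 h2'].
  apply: dseq_add (cat _ _ h1 h2) _; split; rewrite !factE /=; last by case/npair_inj.
  do 5!right; left; exists (prog_code p), (prog_code q).
  by rewrite !pairE !mem_cat h1' h2' orbT.
- move=> p q n a b _ [L1 h1 h1'] _ [L2 h2 h2'].
  apply: dseq_add (cat _ _ h1 h2) _; split; rewrite !factE /=; last by case/npair_inj.
  do 6!right; left; exists (prog_code p), (prog_code q), a.
  by rewrite !mem_cat h1' h2' orbT.
- move=> p q a b _ [L h h'].
  apply: dseq_add h _; split; rewrite !factE /=; last by case/npair_inj.
  do 7!right; left; exists (prog_code p), (prog_code q); split=> //; left.
  by rewrite !pairE.
- move=> p q a k b c _ [L1 h1 h1'] _ [L2 h2 h2'].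
  apply: dseq_add (cat _ _ h1 h2) _; split; rewrite !factE /=; last by case/npair_inj.
  do 7!right; left; exists (prog_code p), (prog_code q); split=> //; right; exists k, b.
  by rewrite !pairE !mem_cat h1' h2' orbT.
- move=> p a n f _ [L h h'] _ ih.
  have ihm m : m <= n -> exists2 L, derivation_seq (fact_step (oracle A)) L &
      forall k, k < m -> fact (prog_code p) (npair a k) (f k).+1 \in L.
    elim: m => [|m ihm] mn; first by exists [::] => //; exact: dseq_nil.
    have [L1 h1 h1'] := ihm (ltnW mn); have [L2 h2 h2'] := ih _ mn.
    exists (L1 ++ L2); first exact: cat.
    move=> k; rewrite ltnS leq_eqVlt mem_cat => /predU1P[->|/h1' -> //].
    by rewrite h2' orbT.
  have [L' hL hL'] := ihm n (leqnn n).
  apply: dseq_add (cat _ _ h hL) _; split; rewrite !factE /=; last by case/npair_inj.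
  do 8!right; exists (prog_code p); rewrite mem_cat h'; do 2!split=> //.
  by move=> k kn; exists (f k); rewrite mem_cat hL' ?orbT.
Qed.

Lemma evalP (A : natset) p x v :
  eval A p x v <-> exists d, derives (fact_step (oracle A)) d (fact (prog_code p) x v).
Proof.
split=> [/eval_dseq[L hL]|[d]]; last exact: derives_sound.
exact: (dseq_derives (@fact_step_mono _) hL).
Qed.

Definition Ev A e x v := exists p, prog_code p = e /\ eval A p x v.

Lemma Ev_prog A p x v : Ev A (prog_code p) x v <-> eval A p x v.
Proof. by split=> [[q [/prog_code_inj ->]]|h] //; exists p. Qed.

Lemma Ev_fun A e x v w : Ev A e x v -> Ev A e x w -> v = w.
Proof. by move=> [p [<- h]] /Ev_prog; apply: eval_fun. Qed.

(** The check on e excludes spurious facts: [step] does not inspect components that are never run,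
    such as q in a recursion of depth 0. *)
Lemma EvP A e x v : Ev A e x v <-> (exists d, derives code_step d e) /\
  exists d, derives (fact_step (oracle A)) d (fact e x v).
Proof.
rewrite is_codeP; split=> [[p [<- /evalP h]]|[[p <-] /evalP h]]; last by exists p.
by split=> //; exists p.
Qed.

Lemma CE_is_code A f : computable_in A f -> enumerable_in A (fun x => exists d, derives code_step d (f x)).
Proof.
move=> hf; rewrite /derives /derivation /code_step; enumerability.
Qed.

Lemma CE_derives A O d f : enumerable_in A (fun z => O (left z) (right z)) -> computable_in A d -> computable_in A f ->
  enumerable_in A (fun x => derives (fact_step O) (d x) (f x)).
Proof.
move=> hO hd hf; rewrite /derives /derivation /fact_step /step /fact /fcode /farg /fval.
enumerability.
Qed.

Lemma CE_Ev A e x v : computable_in A e -> computable_in A x -> computable_in A v ->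
  enumerable_in A (fun z => Ev A (e z) (x z) (v z)).
Proof.
move=> he hx hv; apply: CE_ext (fun z => iff_sym (EvP A (e z) (x z) (v z))) _.
apply: CE_and; first exact: CE_is_code.
apply: (@CE_ex _ (fun z d => derives (fact_step (oracle A)) d (fact (e z) (x z) (v z)))).
rewrite /fact; apply: CE_derives; try by computability.
rewrite /oracle; enumerability.
Qed.

(** * Jumps and highness *)

Fixpoint subst_oracle (r p : prog) : prog :=
  match p with
  | POracle => r
  | PPair p q => PPair (subst_oracle r p) (subst_oracle r q)
  | PComp p q => PComp (subst_oracle r p) (subst_oracle r q)
  | PRec p q => PRec (subst_oracle r p) (subst_oracle r q)
  | PMin p => PMin (subst_oracle r p)
  | _ => p
  end.

Lemma eval_subst (X A : natset) r p x v : (forall n, eval A r n (X n)) ->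
  eval X p x v -> eval A (subst_oracle r p) x v.
Proof.
move=> hr; elim=> {p x v} /=; by [econstructor; eauto|eauto].
Qed.

Lemma comp_turing X A f : turing_le X A -> computable_in X f -> computable_in A f.
Proof. by move=> [r hr] [p hp]; exists (subst_oracle r p) => n; apply: eval_subst. Qed.

Lemma CE_turing X A P : turing_le X A -> enumerable_in X P -> enumerable_in A P.
Proof. by move=> h [q cq hq]; exists q => //; apply: comp_turing cq. Qed.

Lemma turing_le_trans B A C : turing_le A B -> turing_le B C -> turing_le A C.
Proof. by move=> h1 h2; apply: (comp_turing h2). Qed.

Lemma turing_le0 A : turing_le natset0 A.
Proof. exact: (comp_const A 0). Qed.

Lemma comp0 A f : computable_in natset0 f -> computable_in A f.
Proof. exact: comp_turing (turing_le0 A). Qed.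

Lemma CE0 A P : enumerable_in natset0 P -> enumerable_in A P.
Proof. exact: CE_turing (turing_le0 A). Qed.

Lemma CE_jump A : enumerable_in A (fun x => jump A x).
Proof.
apply: (@CE_ext _ (fun x => exists v, Ev A x x v)); last first.
  by apply: (@CE_ex _ (fun x v => Ev A x x v)); apply: CE_Ev; computability.
move=> x; rewrite /jump asboolE; split=> [[v [p [h1 h2]]]|[p [v [h1 h2]]]].
  by exists p, v.
by exists v, p.
Qed.

(** The value g x is the code of the program that discards its input and runs p on x; it is obtained
    from x without an oracle. *)
Lemma jump_complete A P : enumerable_in A P ->
  exists2 g, (forall B, computable_in B g) & forall x, P x <-> jump A (g x).
Proof.
move=> /CE_domain[p hp].
exists (fun x => npair 6 (npair (prog_code p) (prog_code (const_prog x)))).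
  move=> B; have h : computable_in B (fun x => prog_code (const_prog x)); last by computability.
  apply: (@comp_ext _ (fun x => nat_rect (fun _ => nat) (npair 0 0)
    ((fun x k r => npair 6 (npair (npair 1 0) r)) x) x)).
    by elim=> //= k ->.
  by apply: comp_rec; computability.
move=> x; rewrite hp /jump asboolE; split=> [[v h]|[q [v [e h]]]].
  exists (PComp p (const_prog x)), v; split=> //.
  by apply: eval_comp h; apply: eval_const.
move: e; rewrite -[npair 6 _]/(prog_code (PComp p (const_prog x))) => /prog_code_inj e.
rewrite e in h; inversion h; subst; exists v.
by match goal with H : eval A (const_prog x) _ _ |- _ =>
  rewrite -(eval_fun H (eval_const _ _ _)) end.
Qed.

(* As the jump of A computes the double jump, totality is Sigma_2 in A; [N e n]
   says that the first n candidate witnesses of totality of e all fail. *)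
Lemma high_nontotal (a : set natset) : turing_degree a -> high a ->
  exists A : natset, a = deg A /\
  forall C : nat -> nat -> Prop, enumerable_in natset0 (fun z => C (left z) (right z)) ->
  exists2 N : nat -> nat -> Prop, enumerable_in A (fun z => N (left z) (right z)) &
  forall e, ((forall x, C e x) -> exists m, forall n, m <= n -> ~ N e n) /\
            ((exists x, ~ C e x) -> forall n, N e n).
Proof.
move=> [A1 ea] [X [Y [[X1 [A0 hA0 hX1] hX] [A hA hY] XY]]].
exists A; split.
  rewrite ea in hA *; case: hA => h1 h2.
  apply/seteqP; split=> B [b1 b2]; split.
  - exact: turing_le_trans h2.
  - exact: turing_le_trans b2.
  - exact: turing_le_trans h1.
  - exact: turing_le_trans b2.
move=> C /(CE_turing hA0.2)/jump_complete[g cg hg].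
have dJ : decidable_in X1 (jump A0) by exact: hX1.2.
have [g2 cg2 hg2] : exists2 g, (forall B, computable_in B g) &
    forall e, (exists x, ~ C e x) <-> jump X1 (g e).
  apply: jump_complete; apply: (@CE_ext _ (fun e => exists x, ~~ jump A0 (g (npair e x)))); last by enumerability.
  move=> e; split=> -[x hx]; exists x; have := hg (npair e x); rewrite !pairE => h.
    by move=> /h; apply/negP.
  by apply/negP => /h.
have [p hp] : turing_le (jump X1) (jump A).
  apply: turing_le_trans hX.2 _; apply: turing_le_trans XY hY.1.
have [J cJ hJ] : exists2 J : nat -> Prop, enumerable_in A J & forall x, J x <-> jump A x.
  by exists (fun x => jump A x) => //; exact: CE_jump.
(* Answers 1 about the jump of A are certified by its enumeration, answers 0 are taken on trust;
   such derivations are enumerable in A. *)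
pose O1 y b := b = 0 \/ (b = 1 /\ J y).
have [q cq hq] : enumerable_in A (fun z => derives (fact_step O1) (right z) (fact (prog_code p) (g2 (left z)) 0)).
  by rewrite /fact; apply: CE_derives; [rewrite /O1; enumerability|computability|computability].
(* Entry i of d trusted a wrong answer 0. This is enumerable in A, so a bad candidate gets
   refuted. *)
pose neg d i := fcode (sq (right d) i) = npair 4 0 /\ fval (sq (right d) i) = 0 /\
  J (farg (sq (right d) i)).
(* A candidate m pairs a derivation with a witness that it is one. *)
exists (fun e n => forall m, m < n.+1 -> (q (npair (npair e (left m)) (right m)) != 0) \/
   exists i, i < left (left m) /\ neg (left m) i).
  by rewrite /neg /fcode /fval /farg; enumerability.
move=> e.
have tot : (forall x, C e x) <-> exists d, derives (fact_step O1) d (fact (prog_code p) (g2 e) 0)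
    /\ forall i, i < left d -> ~ neg d i.
  have -> : (forall x, C e x) <-> ~ jump X1 (g2 e).
    rewrite -hg2; split=> [h [x nC]|h x]; first exact: nC (h x).
    by apply: contrapT => h'; apply: h; exists x.
  have -> : ~ jump X1 (g2 e) <-> eval (jump A) p (g2 e) 0.
    have := hp (g2 e); case: (jump X1 (g2 e)) => // h; split=> //.
    by move=> /(eval_fun h).
  rewrite evalP; split=> -[d].
    move=> [dd di]; exists d; split; first split=> //.
      move=> i id; have [h1 h2] := dd i id; split=> // /h2.
      by rewrite /oracle /O1 hJ; case: (jump A _) => ->; [right|left].
    move=> i id [n1 [n2 /hJ n3]]; have [_ /(_ n1)] := dd i id.
    by rewrite /oracle n2 n3.
  move=> [[dd di] hn]; exists d; split=> // i id; have [h1 h2] := dd i id; split=> // h4.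
  have := h2 h4; rewrite /oracle /O1 => -[h0|[-> /hJ ->]//].
  by rewrite h0; case E : (jump A _) => //; case: (hn i id); split=> //; split=> //; apply/hJ.
split=> [/tot[d [dd hn]]|].
  have := hq (npair e d); rewrite !pairE => -[/(_ dd)[w hw] _].
  exists (npair d w) => n mn /(_ (npair d w)); rewrite ltnS mn !pairE hw => /(_ isT)[//|].
  by move=> [i [id]]; apply: hn.
move=> [x hx] n m mn; case: eqP => q0; [right|by left].
apply: contrapT => h; apply: hx; apply: (proj2 tot); exists (left m); split.
  by have := hq (npair e (left m)); rewrite !pairE => -[_]; apply; exists (right m).
by move=> i id ni; apply: h; exists i.
Qed.

(** * Code books *)

Section bsum_theory.
Transparent bsum.
Implicit Types (f g : nat -> nat) (m n c : nat).

Lemma bsum0 f : bsum 0 f = 0. Proof. exact: big_ord0. Qed.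

Lemma bsumS n f : bsum n.+1 f = bsum n f + f n.
Proof. exact: big_ord_recr. Qed.

Lemma leq_bsum n f g : (forall i, i < n -> f i <= g i) -> bsum n f <= bsum n g.
Proof. by move=> h; apply: leq_sum => i _; apply: h. Qed.

Lemma eq_bsum n f g : (forall i, i < n -> f i = g i) -> bsum n f = bsum n g.
Proof. by move=> h; apply: eq_bigr => i _; apply: h. Qed.

Lemma bsumD n f g : bsum n (fun i => f i + g i) = bsum n f + bsum n g.
Proof. exact: big_split. Qed.

Lemma bsum_distr n c f : c * bsum n f = bsum n (fun i => c * f i).
Proof. exact: big_distrr. Qed.

Lemma bsum_const n c : bsum n (fun=> c) = n * c.
Proof. by rewrite /bsum sum_nat_const card_ord. Qed.

Lemma bsum_exchange m n (F : nat -> nat -> nat) :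
  bsum m (fun i => bsum n (fun j => F i j)) = bsum n (fun j => bsum m (fun i => F i j)).
Proof. exact: exchange_big. Qed.

Lemma bsum_cat m n f : bsum (m + n) f = bsum m f + bsum n (fun i => f (m + i)).
Proof. by rewrite /bsum big_split_ord. Qed.

Lemma bsum_mul a b f : bsum (a * b) f = bsum b (fun j => bsum a (fun i => f (i + a * j))).
Proof.
elim: b => [|b ih]; first by rewrite muln0 !bsum0.
rewrite mulnS addnC bsum_cat ih bsumS; congr addn.
by apply: eq_bsum => i _; rewrite addnC.
Qed.

Lemma bsum_geq n f i : i < n -> f i <= bsum n f.
Proof. by move=> lt; rewrite /bsum (bigD1 (Ordinal lt)) //= leq_addr. Qed.

Lemma bsum_lt_ex n (P : nat -> bool) : bsum n (fun i => P i) < n ->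
  exists2 i, i < n & ~~ P i.
Proof.
move=> lt; apply: contrapT => h; move: lt; rewrite ltnNge => /negP; apply.
rewrite -[leqLHS]muln1 -bsum_const; apply: leq_bsum => i lt.
by rewrite lt0b; apply: contrapT => /negP np; apply: h; exists i.
Qed.

Lemma bsum_widen m n f : m <= n -> bsum m f <= bsum n f.
Proof. by move=> /subnKC <-; rewrite bsum_cat leq_addr. Qed.

Lemma bexP n (P : nat -> bool) : reflect (exists2 i, i < n & P i) (bex n P).
Proof.
apply: (iffP existsP) => [[i Pi]|[i lt Pi]]; first by exists i.
by exists (Ordinal lt).
Qed.

Lemma ballP n (P : nat -> bool) : reflect (forall i, i < n -> P i) (ball n P).
Proof.
apply: (iffP forallP) => [h i lt|h i]; first exact: (h (Ordinal lt)).
exact: h.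
Qed.

Lemma bex_bsum n (P : nat -> bool) : (bex n P : nat) <= bsum n (fun i => P i).
Proof.
by case: bexP => // -[i lt Pi]; apply: leq_trans (bsum_geq _ lt); rewrite Pi.
Qed.
End bsum_theory.

Section bits.
Transparent bit.

Lemma bit_small z u i : z < 2 ^ u -> u <= i -> bit z i = false.
Proof.
by move=> h ui; rewrite /bit divn_small // (leq_trans h) // leq_exp2l.
Qed.

Lemma bit_lt w i : bit w i -> i < w.
Proof.
rewrite ltnNge; apply: contraTN => /leq_ltn_trans h; apply/negP.
by rewrite (@bit_small w i) //; apply: h; apply: ltn_expl.
Qed.

Lemma bit_low z u t i : i < u -> bit (z + 2 ^ u * t) i = bit z i.
Proof.
move=> iu; have -> : 2 ^ u * t = (2 ^ (u - i) * t) * 2 ^ i.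
  by rewrite mulnAC -expnD subnK // ltnW.
rewrite /bit divnDMl ?expn_gt0 // oddD oddM oddX subn_eq0 leqNgt iu /=.
by rewrite addbF.
Qed.

Lemma bit_high z u t i : z < 2 ^ u -> bit (z + 2 ^ u * t) (u + i) = bit t i.
Proof.
by move=> zu; rewrite /bit expnD divnMA addnC (mulnC (2 ^ u)) divnMDl ?expn_gt0 // (divn_small zu) addn0.
Qed.

Lemma bit_mod s l i : i < l -> bit (s %% 2 ^ l) i = bit s i.
Proof. by move=> il; rewrite {2}(divn_eq s (2 ^ l)) addnC mulnC bit_low. Qed.

Lemma bit_bool (b : bool) : bit b 0 = b.
Proof. by rewrite /bit expn0 divn1 oddb. Qed.

Lemma bit_top L s (b : bool) : s < 2 ^ L -> bit (s + 2 ^ L * b) L = b.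
Proof. by move=> h; have := bit_high b 0 h; rewrite addn0 bit_bool. Qed.

Lemma add_bit_lt L s (b : nat) : s < 2 ^ L -> b < 2 -> s + 2 ^ L * b < 2 ^ L.+1.
Proof. by rewrite expnS => h; case: b => [|[|]] //; lia. Qed.

Lemma bit_inj L a b : a < 2 ^ L -> b < 2 ^ L ->
  (forall i, i < L -> bit a i = bit b i) -> a = b.
Proof.
elim: L a b => [|L ih] a b; first by rewrite expn0 !ltnS !leqn0 => /eqP -> /eqP ->.
move=> ha hb h.
rewrite (divn_eq a (2 ^ L)) (divn_eq b (2 ^ L)).
have e : a %% 2 ^ L = b %% 2 ^ L.
  apply: ih => [||i iL]; rewrite ?ltn_mod ?expn_gt0 //.
  by rewrite !bit_mod //; apply: h; apply: ltnW.
have := h L (ltnSn L); rewrite e /bit.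
have : a %/ 2 ^ L < 2 by rewrite ltn_divLR ?expn_gt0 // -expnS.
have : b %/ 2 ^ L < 2 by rewrite ltn_divLR ?expn_gt0 // -expnS.
by case: (a %/ _) => [|[|]] //; case: (b %/ _) => [|[|]].
Qed.

Lemma bits_exist L (P : nat -> bool) : exists2 a, a < 2 ^ L & forall i, i < L -> bit a i = P i.
Proof.
elim: L => [|L [a aL ha]]; first by exists 0.
exists (a + 2 ^ L * P L); first by apply: add_bit_lt => //; case: (P L).
move=> i; rewrite ltnS leq_eqVlt => /predU1P[->|lt]; last by rewrite bit_low // ha.
exact: bit_top.
Qed.
End bits.

(** Each position in P halves the number of words: in the induction the top bit is either forced or
    free. *)
Lemma agree_count L (P : nat -> bool) t0 :
  bsum (2 ^ L) (fun t => ball L (fun i => P i ==> (bit t i == bit t0 i)))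
    * 2 ^ bsum L (fun i => P i) = 2 ^ L.
Proof.
elim: L => [|L ih].
  rewrite expn0 bsumS !bsum0 add0n; suff -> : ball 0 (fun i => P i ==> (bit 0 i == bit t0 i)) by [].
  exact/ballP.
pose B t := ball L (fun i => P i ==> (bit t i == bit t0 i)).
have -> : bsum (2 ^ L.+1) (fun t => ball L.+1 (fun i => P i ==> (bit t i == bit t0 i))) =
   (if P L then 1 else 2) * bsum (2 ^ L) (fun t => B t).
  rewrite expnSr bsum_mul.
  have h t (b : bool) : t < 2 ^ L -> ball L.+1 (fun i => P i ==> (bit (t + 2 ^ L * b) i == bit t0 i)) =
      B t && (P L ==> (b == bit t0 L)).
    move=> tL; have bL : bit (t + 2 ^ L * b) L = b.
      exact: bit_top.
    apply/ballP/andP => [h|[/ballP h1 h2] i].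
      split; last by rewrite -{1}bL; apply: h.
      by apply/ballP => i iL; rewrite -(@bit_low _ L b) //; apply: h; apply: ltnW.
    rewrite ltnS leq_eqVlt => /predU1P[->|lt]; first by rewrite bL.
    by rewrite bit_low //; apply: h1.
  rewrite 2!bsumS bsum0 add0n.
  rewrite (eq_bsum (fun t tL => congr1 nat_of_bool (h t false tL))).
  rewrite (eq_bsum (fun t tL => congr1 nat_of_bool (h t true tL))).
  case: (P L) => /=.
    by rewrite mul1n; case: (bit t0 L) => /=; rewrite -bsumD; apply: eq_bsum => t _;
      rewrite ?andbT ?andbF ?addn0.
  rewrite mul2n -addnn; congr addn; apply: eq_bsum => t _; by rewrite andbT.
rewrite bsumS expnD [RHS]expnSr -[in RHS]ih -/(B _).
move: (bsum (2 ^ L) _) (2 ^ bsum L _) => a b.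
by case: (P L); rewrite ?mul1n ?expn1 ?expn0 ?muln1; lia.
Qed.

Section greedy.
Variables (N q : nat) (bad : nat -> bool) (clash : nat -> nat -> bool).
Hypothesis clash_count : forall t, bsum N (fun t' => clash t t') <= q.

(** Bad words and words clashing with one of those chosen so far are fewer than N, so a further word
    can be picked. *)
Lemma greedy_choice K : bsum N (fun t => bad t) + K * q < N ->
  exists f : nat -> nat, forall c, c < K ->
    [/\ f c < N, ~~ bad (f c) & forall c', c' < c -> ~~ clash (f c') (f c)].
Proof.
elim: K => [|K ih] h; first by exists id.
have [|f hf] := ih; first by apply: leq_ltn_trans h; rewrite leq_add2l leq_mul2r leqnSn orbT.
have [t tN] : exists2 t, t < N & ~~ (bad t || bex K (fun c => clash (f c) t)).
  apply: bsum_lt_ex; apply: leq_ltn_trans h.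
  apply: (@leq_trans (bsum N (fun t => bad t + bsum K (fun c => clash (f c) t)))).
    apply: leq_bsum => t _; apply: leq_trans (leq_add (leqnn _) (bex_bsum _ _)).
    by case: (bad t).
  rewrite bsumD leq_add2l bsum_exchange mulSn.
  apply: leq_trans (leq_addl _ _); rewrite -bsum_const; exact: leq_bsum.
rewrite negb_or => /andP[nb /bexP nc].
exists (fun c => if c == K then t else f c) => c; rewrite ltnS leq_eqVlt => /predU1P[->|lt].
  rewrite eqxx; split=> // c' c'K; rewrite (ltn_eqF c'K).
  by apply/negP => cl; apply: nc; exists c'.
have [h1 h2 h3] := hf c lt; rewrite (ltn_eqF lt); split=> // c' c'c.
by rewrite (ltn_eqF (ltn_trans c'c lt)); apply: h3.
Qed.
End greedy.

(* A datum y codes a finite set of numbers (the bits of [yr y]) and a clopen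
   set (the sequences whose first [yl y] bits form a number s with
   [bit (yw y) s]). *)
Definition yr y := left y.
Definition yl y := left (right y).
Definition yw y := right (right y).

(** A bit of a number sits at a position below that number, so the bound [yr y] loses none. *)
Definition rcount u y := bsum (yr y) (fun i => (u <= i) && bit (yr y) i).
Definition wcount y := bsum (2 ^ yl y) (fun s => bit (yw y) s).

Definition valid u v y :=
  [&& v <= yl y, 2 * v <= rcount v y & wcount y * 2 ^ (3 * u) <= 2 ^ yl y].

Definition avoids u z y t := ~~ bit (yw y) ((z + 2 ^ u * t) %% 2 ^ yl y).

Definition extcount u z y := bsum (2 ^ (yl y - u)) (fun p => bit (yw y) (z + 2 ^ u * p)).

(* Given the first u bits z, the clopen set of y has measure at most 2^-k. *)
Definition thin k u z y := 2 ^ k * extcount u z y <= 2 ^ (yl y - u).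

Definition agree u v y t t' :=
  ball v (fun i => (u <= i) && bit (yr y) i ==> (bit t (i - u) == bit t' (i - u))).

(** The data in D0 are settled in this block, those in D1 in the next: [thin (n + 5)] here is the
    [thin (n + 4)] assumed by [book_exists] for n.+1. *)
Definition word_ok n u v z D0 D1 t :=
  [&& t < 2 ^ (v - u),
      ball n (fun e => (sq D0 e != 0) ==> avoids u z (sq D0 e).-1 t) &
      ball n.+1 (fun e => (sq D1 e != 0) ==>
         thin (n + 5) v (z + 2 ^ u * t) (sq D1 e).-1)].

Definition clash n u v D0 t t' :=
  bex n (fun e => (sq D0 e != 0) && agree u v (sq D0 e).-1 t t').

Definition book n u v z D0 D1 T := ball (2 ^ (n + 3)) (fun c =>
  word_ok n u v z D0 D1 (sq T c) && ball c (fun c' => ~~ clash n u v D0 (sq T c') (sq T c))).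

Lemma leq_pmul2r_imp k a b : 0 < k -> a * k <= b * k -> a <= b.
Proof. by move=> k0; rewrite leq_pmul2r. Qed.

Section counts.
Variables (n u v z y : nat).
Hypotheses (uv : u <= v) (zu : z < 2 ^ u).

(** As [yl y <= v], the word decides membership; every continuation of z inside the clopen set
    begins the same number of words, 2^(v - yl y). *)
Lemma avoids_count k : u <= yl y -> yl y <= v -> thin k u z y ->
  bsum (2 ^ (v - u)) (fun t => ~~ avoids u z y t) * 2 ^ k <= 2 ^ (v - u).
Proof.
move=> ul lv; rewrite /thin => h; set l := yl y in ul lv h *.
have e : v - u = (l - u) + (v - l) by lia.
rewrite [in bsum _ _]e expnD bsum_mul.
rewrite (eq_bsum (g := fun=> extcount u z y)); last first.
  move=> t' _; rewrite /extcount; apply: eq_bsum => p hp; congr nat_of_bool.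
  rewrite /avoids negbK -/l; congr bit.
  have -> : z + 2 ^ u * (p + 2 ^ (l - u) * t') = t' * 2 ^ l + (z + 2 ^ u * p).
    by rewrite -{2}(subnKC ul) expnD; lia.
  rewrite modnMDl modn_small // -(subnKC ul) expnD.
  have : 2 ^ u * p.+1 <= 2 ^ u * 2 ^ (l - u) by rewrite leq_mul2l hp orbT.
  by rewrite mulnS; lia.
rewrite bsum_const e expnD -mulnA [leqRHS]mulnC leq_mul2l [_ * 2 ^ k]mulnC.
by rewrite h orbT.
Qed.

Lemma extcount_sum : v <= yl y ->
  bsum (2 ^ (v - u)) (fun t => extcount v (z + 2 ^ u * t) y) <= wcount y.
Proof.
move=> vl; set l := yl y in vl *.
rewrite /wcount -/l -(subnKC (leq_trans uv vl)) expnD bsum_mul bsum_exchange.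
apply: leq_trans (bsum_geq _ zu).
have -> : l - u = (v - u) + (l - v) by lia.
rewrite expnD bsum_mul bsum_exchange; apply: leq_bsum => p _; rewrite -/l.
apply: leq_bsum => t _; rewrite leq_eqVlt; apply/orP; left; apply/eqP.
congr (nat_of_bool (bit _ _)); rewrite -{1}(subnKC uv) expnD; lia.
Qed.

(** Markov's inequality. Averaged over the words, the conditional measure is at most 2^u 2^-(3u) =
    2^-(2u); multiplied by 2^(n+5) it is at most 2^-(n+5), because n + 5 <= u. *)
Lemma thin_count : n + 5 <= u -> valid u v y ->
  bsum (2 ^ (v - u)) (fun t => ~~ thin (n + 5) v (z + 2 ^ u * t) y) * 2 ^ (n + 5) <= 2 ^ (v - u).
Proof.
move=> nu /and3P[vl _ hw]; set l := yl y in vl hw.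
set S := bsum _ _.
have h1 : S * 2 ^ (l - v) <= 2 ^ (n + 5) * wcount y.
  apply: leq_trans (leq_mul (leqnn _) (extcount_sum vl)).
  rewrite /S mulnC !bsum_distr; apply: leq_bsum => t _.
  by rewrite /thin -/l; case: (leqP (_ * extcount _ _ _) _) => [_|/ltnW h] /=; rewrite ?muln0 ?muln1.
apply: (@leq_pmul2r_imp (2 ^ (l - v) * 2 ^ (3 * u))); first by rewrite muln_gt0 !expn_gt0.
apply: (@leq_trans (2 ^ (n + 5) * 2 ^ (n + 5) * (wcount y * 2 ^ (3 * u)))).
  have -> : S * 2 ^ (n + 5) * (2 ^ (l - v) * 2 ^ (3 * u)) =
     (S * 2 ^ (l - v)) * (2 ^ (n + 5) * 2 ^ (3 * u)) by lia.
  by apply: leq_trans (leq_mul h1 (leqnn _)) _; lia.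
apply: leq_trans (leq_mul (leqnn _) hw) _.
by rewrite -!expnD leq_exp2l //; lia.
Qed.

(** The bound [yr y <= v] places all counted positions in the block, so [agree_count] applies with
    at least 2u positions. *)
Lemma clash_one_count t : yr y <= v -> 2 * u <= rcount u y ->
  bsum (2 ^ (v - u)) (fun t' => agree u v y t t') * 2 ^ (2 * u) <= 2 ^ (v - u).
Proof.
clear zu; move=> rv hr; pose P j := bit (yr y) (u + j).
have hP : 2 * u <= bsum (v - u) (fun j => P j).
  apply: leq_trans hr _; rewrite /rcount; apply: leq_trans (bsum_widen _ rv) _.
  rewrite -{1}(subnKC uv) bsum_cat (eq_bsum (g := fun=> 0)); last first.
    by move=> i iu; rewrite leqNgt iu.
  rewrite bsum_const muln0 add0n; apply: leq_bsum => i _.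
  by rewrite leq_addr.
rewrite -[leqRHS](agree_count (v - u) P t).
apply: leq_mul; last by rewrite leq_exp2l.
apply: leq_bsum => t' _.
suff : agree u v y t t' -> ball (v - u) (fun i => P i ==> (bit t' i == bit t i)).
  by case: agree => // /(_ isT) ->.
move=> /ballP h; apply/ballP => j jl; apply/implyP => Pj.
have := h (u + j); rewrite leq_addr -/(P j) Pj addKn /= eq_sym; apply; lia.
Qed.
End counts.

Lemma bsum_bex_leq N n (P : nat -> nat -> bool) q :
  (forall e, e < n -> bsum N (fun t => P e t) <= q) ->
  bsum N (fun t => bex n (fun e => P e t)) <= n * q.
Proof.
move=> h; apply: (@leq_trans (bsum N (fun t => bsum n (fun e => P e t)))).
  by apply: leq_bsum => t _; exact: (bex_bsum n (fun e => P e t)).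
by rewrite bsum_exchange -bsum_const; apply: leq_bsum.
Qed.

Lemma bsum0_const N : bsum N (fun=> 0) = 0.
Proof. by rewrite bsum_const muln0. Qed.

(** The fractions of words excluded are at most n 2^-(n+4) by avoidance, (n+1) 2^-(n+5) by thinness,
    and n 2^(n+3) 2^-(2u) <= n 2^-(n+4) by clashes with the words chosen before. Their sum is below
    1. *)
Lemma book_exists n u v z D0 D1 : n + 5 <= u -> u <= v -> z < 2 ^ u ->
  (forall e, e < n -> sq D0 e != 0 -> let y := (sq D0 e).-1 in
     [/\ u <= yl y <= v, yr y <= v, 2 * u <= rcount u y & thin (n + 4) u z y]) ->
  (forall e, e < n.+1 -> sq D1 e != 0 -> valid u v (sq D1 e).-1) ->
  exists T, book n u v z D0 D1 T.
Proof.
move=> nu uv zu h0 h1; set N := 2 ^ (v - u).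
pose badA t := bex n (fun e => (sq D0 e != 0) && ~~ avoids u z (sq D0 e).-1 t).
pose badB t := bex n.+1 (fun e => (sq D1 e != 0) && ~~ thin (n + 5) v (z + 2 ^ u * t) (sq D1 e).-1).
have divM a k : a * 2 ^ k <= N -> a <= N %/ 2 ^ k by rewrite leq_divRL ?expn_gt0.
have cA : bsum N (fun t => badA t) <= n * (N %/ 2 ^ (n + 4)).
  apply: bsum_bex_leq => e en; case: eqVneq => [|ne] /=; first by rewrite bsum0_const.
  have [/andP[a1 a2] a3 a4 a5] := h0 e en ne; apply: divM; exact: avoids_count.
have cB : bsum N (fun t => badB t) <= n.+1 * (N %/ 2 ^ (n + 5)).
  apply: bsum_bex_leq => e en; case: eqVneq => [|ne] /=; first by rewrite bsum0_const.
  by apply: divM; apply: thin_count => //; apply: h1.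
have cC t : bsum N (fun t' => clash n u v D0 t t') <= n * (N %/ 2 ^ (2 * u)).
  apply: bsum_bex_leq => e en; case: eqVneq => [|ne] /=; first by rewrite bsum0_const.
  by have [a1 a3 a4 a5] := h0 e en ne; apply: divM; apply: clash_one_count.
have [|f hf] := greedy_choice (bad := fun t => badA t || badB t) cC (K := 2 ^ (n + 3)).
  set a := n * (N %/ 2 ^ (n + 4)) in cA; set b := n.+1 * (N %/ 2 ^ (n + 5)) in cB.
  have ha : a * 2 ^ (n + 4) <= n * N by rewrite /a -mulnA leq_mul2l leq_trunc_div orbT.
  have hb : b * 2 ^ (n + 4) <= n.+1 * N.
    apply: leq_trans (leq_mul (leqnn _) (_ : 2 ^ (n + 4) <= 2 ^ (n + 5))) _.
      by rewrite leq_exp2l // leq_add2l.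
    by rewrite /b -mulnA leq_mul2l leq_trunc_div orbT.
  have hc : (2 ^ (n + 3) * (n * (N %/ 2 ^ (2 * u)))) * 2 ^ (n + 4) <= n * N.
    have -> : (2 ^ (n + 3) * (n * (N %/ 2 ^ (2 * u)))) * 2 ^ (n + 4) =
       n * (N %/ 2 ^ (2 * u) * 2 ^ (n + 3 + (n + 4))) by rewrite [in RHS]expnD; lia.
    rewrite leq_mul2l; apply/orP; right.
    apply: leq_trans (leq_trunc_div N (2 ^ (2 * u))).
    by rewrite leq_mul2l leq_exp2l //; apply/orP; right; lia.
  rewrite -(@ltn_pmul2r (2 ^ (n + 4))) ?expn_gt0 //.
  apply: (@leq_ltn_trans (n * N + n.+1 * N + n * N)).
    rewrite mulnDl; apply: leq_add => //.
    apply: leq_trans (leq_add ha hb); rewrite -mulnDl leq_mul2r; apply/orP; right.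
    apply: leq_trans (leq_add cA cB); rewrite -bsumD; apply: leq_bsum => t _.
    by case: (badA t); case: (badB t).
  rewrite -!mulnDl mulnC ltn_mul2l expn_gt0 /=.
  have : n < 2 ^ n by apply: ltn_expl.
  by rewrite expnD; lia.
have [T [_ hT]] := sq_exists (2 ^ (n + 3)) f.
exists T; apply/ballP => c cK; rewrite hT //.
have [fN nb nc] := hf c cK; apply/andP; split; last first.
  by apply/ballP => c' c'c; rewrite hT ?(ltn_trans c'c) //; apply: nc.
move: nb; rewrite negb_or => /andP[/bexP nA /bexP nB].
apply/and3P; split=> //; apply/ballP => e en; apply/implyP => ne; apply: contrapT => /negP h.
  by apply: nA; exists e => //; rewrite ne.
by apply: nB; exists e => //; rewrite ne.
Qed.

(** * Block coding *)

Lemma CE_Ev0 A e x v : computable_in A e -> computable_in A x -> computable_in A v ->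
  enumerable_in A (fun z => Ev natset0 (e z) (x z) (v z)).
Proof.
move=> he hx hv.
have h : enumerable_in A (fun z => Ev natset0 (left z) (left (right z)) (right (right z))).
  by apply: CE0; apply: CE_Ev; computability.
apply: CE_ext (CE_comp (f := fun z => npair (e z) (npair (x z) (v z))) h _); last by computability.
by move=> z; rewrite !pairE.
Qed.

Lemma dec_valid A f g h : computable_in A f -> computable_in A g -> computable_in A h ->
  decidable_in A (fun x => valid (f x) (g x) (h x)).
Proof. by move=> hf hg hh; rewrite /valid /rcount /wcount /yr /yl /yw; computability. Qed.

Lemma dec_book A f1 f2 f3 f4 f5 f6 f7 : computable_in A f1 -> computable_in A f2 -> computable_in A f3 ->
  computable_in A f4 -> computable_in A f5 -> computable_in A f6 -> computable_in A f7 ->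
  decidable_in A (fun x => book (f1 x) (f2 x) (f3 x) (f4 x) (f5 x) (f6 x) (f7 x)).
Proof.
move=> h1 h2 h3 h4 h5 h6 h7.
by rewrite /book /word_ok /clash /agree /thin /extcount /avoids /yr /yl /yw; computability.
Qed.

Lemma comp_table A (f g : nat -> nat) n0 : computable_in A g -> (forall k, f (n0 + k) = g k) -> computable_in A f.
Proof.
move=> cg fg; have [w [_ hw]] := sq_exists n0 f.
apply: (@comp_ext _ (fun n => if n < n0 then sq w n else g (n - n0))); last by computability.
move=> n; case: ltnP => h; first exact: hw.
by rewrite -fg subnKC.
Qed.

(** The search for a next value is known to halt only under [Inv]. The values of f and the halting
    of the iterated search are therefore established along with the invariant. *)
Lemma CE_sequence A (E : nat -> nat -> nat -> Prop) (Inv : nat -> nat -> Prop) s0 :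
  enumerable_in A (fun z => E (left z) (left (right z)) (right (right z))) ->
  Inv 0 s0 -> (forall n s, Inv n s -> exists s', E n s s') ->
  (forall n s s', Inv n s -> E n s s' -> Inv n.+1 s') ->
  exists f, [/\ computable_in A f, f 0 = s0 & forall n, Inv n (f n) /\ E n (f n) (f n.+1)].
Proof.
move=> hE inv0 ex pres.
have [|p hp] := @CE_choice_prog A (fun x s' => E (left x) (right x) s').
  apply: CE_ext (CE_comp (f := fun z => npair (left (left z)) (npair (right (left z)) (right z))) hE _).
    by move=> z; rewrite !pairE.
  by computability.
have /choice[g hg] : forall x, exists s', Inv (left x) (right x) ->
    E (left x) (right x) s' /\ eval A p x s'.
  move=> x; have [/ex[s hs]|ni] := pselect (Inv (left x) (right x)); last by exists 0.
  by have [|s' h1 h2] := hp x; [exists s|exists s'].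
pose f n := nat_rect (fun _ => nat) s0 (fun k r => g (npair k r)) n.
have fS n : Inv n (f n) -> E n (f n) (f n.+1) /\ eval A p (npair n (f n)) (f n.+1).
  by move=> i; have := hg (npair n (f n)); rewrite !pairE; apply.
have fI n : Inv n (f n).
  by elim: n => [//|n ih]; apply: (pres _ _ _ ih); case: (fS n ih).
exists f; split=> // [|n]; last by split; [exact: fI|case: (fS n (fI n))].
have : computable_in A (fun z => f (right z)); last first.
  move=> h; apply: (@comp_ext _ (fun n => f (right (npair 0 n)))).
    by move=> n; rewrite pairE.
  by apply: (comp_comp (f := fun z => f (right z)) h); computability.
exists (PRec (const_prog s0) (PComp p PRight)) => z; rewrite -{1}(npairK z).
elim: (right z) => [|k ih]; first by apply: eval_rec0; exact: eval_const.
by apply: eval_recS ih _; apply: eval_comp (eval_right _ _ _) (proj2 (fS k (fI k))).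
Qed.

Definition pcode (Z : natset) l := bsum l (fun i => 2 ^ i * Z i).

Lemma pcode_lt Z l : pcode Z l < 2 ^ l.
Proof.
rewrite /pcode; elim: l => [|l ih]; first by rewrite bsum0.
by rewrite bsumS; apply: add_bit_lt => //; case: (Z l).
Qed.

Lemma bit_pcode Z l i : i < l -> bit (pcode Z l) i = Z i.
Proof.
elim: l => [//|l ih]; rewrite /pcode bsumS -/(pcode Z l) ltnS leq_eqVlt => /predU1P[->|lt].
  by rewrite bit_top // pcode_lt.
by rewrite bit_low // ih.
Qed.

Lemma pcode_eq Z l s : s < 2 ^ l -> (forall i, i < l -> bit s i = Z i) -> s = pcode Z l.
Proof.
move=> sl h; apply: (@bit_inj l) => //; first exact: pcode_lt.
by move=> i il; rewrite h // bit_pcode.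
Qed.

(* At stage n, z codes the first u bits of the set under construction and h the
   first n bits of the message; D0 and D1 list the outputs of the first n and
   n.+1 programs that are waited for, on the previous and on the current block.
   Since D0 and D1 bound the data they list, the next two block ends [sv] and
   [st] are large enough for these data. *)
Definition su s := left s.
Definition sz s := left (right s).
Definition sD0 s := left (right (right s)).
Definition sD1 s := left (right (right (right s))).
Definition sh s := right (right (right (right s))).
Definition sv s := su s + 1 + sD0 s.
Definition st s := sv s + 1 + sD1 s.
Definition state u z D0 D1 h := npair u (npair z (npair D0 (npair D1 h))).

Lemma stateE u z D0 D1 h : (su (state u z D0 D1 h) = u) * (sz (state u z D0 D1 h) = z) *
  (sD0 (state u z D0 D1 h) = D0) * (sD1 (state u z D0 D1 h) = D1) * (sh (state u z D0 D1 h) = h).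
Proof. by rewrite /su /sz /sD0 /sD1 /sh /state !pairE. Qed.

Definition active k u v D := forall e, e < k -> sq D e != 0 ->
  Ev natset0 e (npair u v) (sq D e).-1 /\ valid u v (sq D e).-1.

(* Entry 0 means that e is not waited for, entry y.+1 that e outputs y. *)
Definition entries mask k u v D := tl D k = 0 /\ forall e, e < k ->
  (~~ bit mask e /\ sq D e = 0) \/
  (bit mask e /\ exists y, sq D e = y.+1 /\ Ev natset0 e (npair u v) y /\ valid u v y).

Lemma entries_fun mask k u v D D' : entries mask k u v D -> entries mask k u v D' -> D = D'.
Proof.
move=> [t0 h] [t0' h']; apply: (@sq_inj k); first by rewrite t0.
move=> e ek; case: (h e ek) => [[b ->]|[b [y [-> [ev _]]]]];
  case: (h' e ek) => [[b' ->]|[b' [y' [-> [ev' _]]]]] //.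
- by rewrite b' in b.
- by rewrite b in b'.
- by rewrite (Ev_fun ev ev').
Qed.

Lemma entries_active mask k u v D : entries mask k u v D -> active k u v D.
Proof.
by move=> [_ h] e ek; case: (h e ek) => [[_ ->]//|[_ [y [-> [h1 h2]]]]].
Qed.

(** * Encoding: one stage and its invariant *)

Section construction.
Variable A : natset.
Variable N : nat -> nat -> Prop.
Hypothesis CE_N : enumerable_in A (fun z => N (left z) (right z)).
Definition convergent e x := exists y, Ev natset0 e x y /\ valid (left x) (right x) y.
Hypothesis N_total : forall e, (forall x, convergent e x) -> exists m, forall n, m <= n -> ~ N e n.
Hypothesis N_partial : forall e, (exists x, ~ convergent e x) -> forall n, N e n.
Definition is_book x T := book (left x) (su (right x)) (sv (right x)) (sz (right x))
  (sD0 (right x)) (sD1 (right x)) T.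
Variable B : nat -> nat -> Prop.
Hypothesis CE_B : forall A, enumerable_in A (fun z => B (left z) (right z)).
Hypothesis B_book : forall x T, B x T -> is_book x T.
Hypothesis B_fun : forall x T T', B x T -> B x T' -> T = T'.
Hypothesis B_ex : forall x, (exists T, is_book x T) -> exists T, B x T.

(** What the message c determines of a stage, through its last bit and the mask [c %/ 2]. Neither A
    nor N occurs, so a decoder can repeat it. *)
Definition dec_step n s c s' := exists T D, B (npair n s) T /\
  entries (c %/ 2) n.+2 (sv s) (st s) D /\
  s' = state (sv s) (sz s + 2 ^ su s * sq T c) (sD1 s) D (sh s + 2 ^ n * (c %% 2)).

(** Only giving up a program requires N; a program may be waited for whether or not [N e n]
    holds. *)
Definition enc_step n s s' := exists c, c < 2 ^ (n + 3) /\ c %% 2 = nat_of_bool (A n) /\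
  dec_step n s c s' /\ forall e, e < n.+2 -> sq (sD1 s') e = 0 -> N e n.

Lemma CE_dec_step C n s c s' : computable_in C n -> computable_in C s -> computable_in C c -> computable_in C s' ->
  enumerable_in C (fun x => dec_step (n x) (s x) (c x) (s' x)).
Proof.
move=> hn hs hc hs'.
rewrite /dec_step /entries /state /st /sv /su /sz /sD0 /sD1 /sh; enumerability; try (apply: CE_Ev0; computability).
by apply: dec_valid; computability.
Qed.

Lemma dec_step_fun n s c s' s'' : dec_step n s c s' -> dec_step n s c s'' -> s' = s''.
Proof.
move=> [T [D [h1 [h2 ->]]]] [T' [D' [h1' [h2' ->]]]].
by rewrite (B_fun h1 h1') (entries_fun h2 h2').
Qed.

(** The clause on [sD0] is what remains of validity at the preceding stage, with the measure bound
    replaced by the thinness that the last word secured. *)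
Definition Inv n s :=
  [/\ n + 5 <= su s, sz s < 2 ^ su s, sh s < 2 ^ n,
   forall e, e < n -> sq (sD0 s) e != 0 -> let y := (sq (sD0 s) e).-1 in
     [/\ su s <= yl y, 2 * su s <= rcount (su s) y & thin (n + 4) (su s) (sz s) y] &
   active n.+1 (su s) (sv s) (sD1 s)].

Lemma Inv_book n s : Inv n s -> exists T, B (npair n s) T.
Proof.
move=> [h1 h2 h3 h4 h5]; apply: B_ex; rewrite /is_book !pairE.
apply: book_exists => //; first by rewrite /sv; lia.
  move=> e en ne; have [a1 a2 a3] := h4 e en ne; split=> //.
    rewrite a1 /=; have := sq_le (sD0 s) e; have := left_le (right (sq (sD0 s) e).-1).
    by have := right_le (sq (sD0 s) e).-1; rewrite /sv /yl; lia.
  by have := sq_le (sD0 s) e; have := left_le (sq (sD0 s) e).-1; rewrite /sv /yr; lia.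
by move=> e en ne; case: (h5 e en ne).
Qed.

Lemma bookW n s T c : B (npair n s) T -> c < 2 ^ (n + 3) ->
  word_ok n (su s) (sv s) (sz s) (sD0 s) (sD1 s) (sq T c) /\
  forall c', c' < c -> ~~ clash n (su s) (sv s) (sD0 s) (sq T c') (sq T c).
Proof.
by move=> /B_book; rewrite /is_book !pairE => /ballP h /h /andP[h1 /ballP h2].
Qed.

Lemma Inv_step n s c s' : Inv n s -> c < 2 ^ (n + 3) -> dec_step n s c s' -> Inv n.+1 s'.
Proof.
move=> [h1 h2 h3 h4 h5] cl [T [D [hB [hD ->]]]].
have [/and3P[w1 /ballP w2 /ballP w3] _] := bookW hB cl.
have uv : su s <= sv s by rewrite /sv; lia.
split; rewrite ?stateE /=.
- by rewrite /sv; lia.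
- rewrite -(subnKC uv) expnD.
  have : 2 ^ su s * (sq T c).+1 <= 2 ^ su s * 2 ^ (sv s - su s) by rewrite leq_mul2l w1 orbT.
  by rewrite mulnS; lia.
- by apply: add_bit_lt => //; rewrite ltn_mod.
- move=> e en ne; have [_ /and3P[v1 v2 v3]] := h5 e en ne; split=> //.
  by have := w3 e en; rewrite ne addSnnS.
- by rewrite /sv !stateE; apply: entries_active hD.
Qed.

(** Waiting for exactly the programs with a valid output on the next argument is a legal choice: any
    other program is not total, so N allows giving it up. *)
Lemma Inv_enc n s : Inv n s -> exists s', enc_step n s s'.
Proof.
move=> i; have [T hT] := Inv_book i.
pose P e := `[< exists y, Ev natset0 e (npair (sv s) (st s)) y /\ valid (sv s) (st s) y >].
have [m ml hm] := bits_exist n.+2 P.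
have /choice[g hg] : forall e, exists d, if P e then exists y, d = y.+1 /\
    Ev natset0 e (npair (sv s) (st s)) y /\ valid (sv s) (st s) y else d = 0.
  move=> e; case E : (P e); last by exists 0.
  by have /asboolP[y [h1 h2]] := E; exists y.+1, y.
have [D [D0 hD]] := sq_exists n.+2 g.
have Am : (A n + m * 2) %/ 2 = m /\ (A n + m * 2) %% 2 = A n.
  by case: (A n); lia.
eexists; exists (A n + m * 2); split.
  by rewrite addnS -addSnnS addn1 in ml *; move: ml; rewrite !expnS; case: (A n); lia.
split; first by case: Am.
split.
  exists T, D; split=> //; split=> //; case: Am => -> _; split=> // e en.
  by have := hg e; rewrite -hD // hm //; case: (P e); [right|left].
move=> e en; rewrite stateE hD //; have := hg e; case E : (P e); first by move=> [y [-> _]].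
move=> _ _.
apply: N_partial; exists (npair (sv s) (st s)) => -[y]; rewrite !pairE => h.
by move/negbT/asboolPn: E; apply; exists y.
Qed.

Lemma enc_sequence : exists f, computable_in A f /\ forall n, Inv n (f n) /\ enc_step n (f n) (f n.+1).
Proof.
(* The value 5 is the first clause of [Inv] at n = 0; the first five bits are thus 0. *)
have [||||f [cf _ hf]] := @CE_sequence A enc_step Inv (state 5 0 0 0 0).
- rewrite /enc_step /sD1; enumerability; apply: CE_dec_step; computability.
- by split; rewrite ?stateE // => e; rewrite sq0.
- exact: Inv_enc.
- by move=> n s s' i [c [c1 [_ [c2 _]]]]; apply: Inv_step c2.
by exists f.
Qed.

(** * The limit set and its decoding *)

Section decoding.
Variable f : nat -> nat.
Hypothesis comp_f : computable_in A f.
Hypothesis f_step : forall n, Inv n (f n) /\ enc_step n (f n) (f n.+1).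

Let u n := su (f n).

Lemma f_stepE n : exists c T D, [/\ c < 2 ^ (n + 3) /\ c %% 2 = nat_of_bool (A n), B (npair n (f n)) T,
  entries (c %/ 2) n.+2 (sv (f n)) (st (f n)) D,
  forall e, e < n.+2 -> sq D e = 0 -> N e n &
  f n.+1 = state (sv (f n)) (sz (f n) + 2 ^ su (f n) * sq T c) (sD1 (f n)) D
     (sh (f n) + 2 ^ n * (c %% 2))].
Proof.
have [_ [c [h1 [h2 [[T [D [h3 [h4 h5]]]] h6]]]]] := f_step n.
by exists c, T, D; split=> //; move: h6; rewrite h5 stateE.
Qed.

Lemma u_step n : u n.+1 = sv (f n).
Proof. by have [c [T [D [_ _ _ _ e]]]] := f_stepE n; rewrite /u e stateE. Qed.

Lemma sD0_step n : sD0 (f n.+1) = sD1 (f n).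
Proof. by have [c [T [D [_ _ _ _ e]]]] := f_stepE n; rewrite e stateE. Qed.

Lemma u_lt n : u n < u n.+1.
Proof. by rewrite u_step /u /sv; lia. Qed.

Lemma u_geq n : n + 5 <= u n.
Proof. by have [[]] := f_step n. Qed.

Lemma u_mono n m : n <= m -> u n <= u m.
Proof.
move=> /subnKC <-; elim: (m - n) => [|k ih]; rewrite ?addn0 // addnS.
exact: leq_trans ih (ltnW (u_lt _)).
Qed.

(** Bit i is settled by stage i, since i < u i. *)
Definition limit_set : natset := fun i => bit (sz (f i)) i.

Lemma bit_sz n i : i < u n -> bit (sz (f n)) i = limit_set i.
Proof.
have coh m k : i < u m -> bit (sz (f (m + k))) i = bit (sz (f m)) i.
  move=> im; elim: k => [|k ih]; rewrite ?addn0 // addnS -ih.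
  have [c [T [D [_ _ _ _ ->]]]] := f_stepE (m + k); rewrite stateE bit_low //.
  by apply: leq_trans im (u_mono (leq_addr _ _)).
move=> im; rewrite /limit_set; case: (leqP n i) => h.
  by have := coh n (i - n) im; rewrite subnKC.
have := coh i (n - i); rewrite subnKC ?(ltnW h) //; apply.
by apply: leq_trans (u_geq i); lia.
Qed.

Lemma sz_pcode n l : l <= u n -> sz (f n) %% 2 ^ l = pcode limit_set l.
Proof.
move=> lu; apply: pcode_eq; first by rewrite ltn_mod expn_gt0.
by move=> i il; rewrite bit_mod // bit_sz // (leq_trans il).
Qed.

Lemma sh_bit n : bit (sh (f n.+1)) n = A n.
Proof.
have [c [T [D [[_ e] _ _ _ ->]]]] := f_stepE n; rewrite stateE e bit_top //.
by have [[]] := f_step n.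
Qed.

Lemma limit_set_le : turing_le limit_set A.
Proof. by have : decidable_in A limit_set; rewrite /limit_set /sz; computability. Qed.

Lemma eventually_active e : (forall x, convergent e x) ->
  exists n0, forall n, n0 <= n -> exists y, [/\ e < n.+1, sq (sD1 (f n)) e = y.+1,
    Ev natset0 e (npair (u n) (u n.+1)) y & valid (u n) (u n.+1) y].
Proof.
(* The message of stage n concerns the block ends u n.+1 and u n.+2, whence the shift by one. *)
move=> /N_total[m hm]; exists (maxn m e).+1 => -[//|n]; rewrite ltnS geq_max => /andP[mn en].
have [c [T [D [_ _ hD hN e1]]]] := f_stepE n.
have en2 : e < n.+2 by lia.
have ne : sq D e != 0 by apply/eqP => /(hN e en2); apply: hm.
exists (sq D e).-1; have [h1 h2] := entries_active hD en2 ne.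
have e2 : u n.+2 = st (f n) by rewrite u_step {1}/sv e1 !stateE.
by rewrite u_step e2 {1}e1 stateE prednK // lt0n.
Qed.

(** The output listed in [sD1] at stage n is listed in [sD0] at stage n.+1, where the chosen word
    avoids its clopen set. *)
Lemma limit_set_avoids e : (forall x, convergent e x) ->
  exists n0, forall n, n0 <= n -> exists y, [/\ Ev natset0 e (npair (u n) (u n.+1)) y,
    valid (u n) (u n.+1) y & ~~ bit (yw y) (pcode limit_set (yl y))].
Proof.
move=> /eventually_active[n0 h]; exists n0 => n /h[y [en hy ev va]]; exists y; split=> //.
have [c [T [D [[cl _] hB _ _ e1]]]] := f_stepE n.+1.
have [/and3P[_ /ballP/(_ e en) hw _] _] := bookW hB cl.
have yl_le : yl y <= u n.+2.
  rewrite u_step /sv sD0_step; have := sq_le (sD1 (f n)) e; rewrite hy.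
  by have := left_le (right y); have := right_le y; rewrite /yl; lia.
by move: hw; rewrite sD0_step hy /= /avoids -(sz_pcode yl_le) e1 stateE.
Qed.

Section decoder.
Variables (e n0 : nat) (Y : natset).
Hypothesis e_active : forall n, n0 <= n -> e < n /\ sq (sD0 (f n)) e != 0.
Hypothesis Y_limit : forall n i, n0 <= n -> bit (yr (sq (sD0 (f n)) e).-1) i ->
  Y i = limit_set i.

(** A message that waits for a diverging program yields no s', so it is merely never found by the
    search. *)
Definition decode n s s' := exists c, c < 2 ^ (n + 3) /\ dec_step n s c s' /\
  forall i, i < sv s -> (i < su s) || ~~ bit (yr (sq (sD0 s) e).-1) i || (bit (sz s') i == Y i).

Lemma decode_exists n : n0 <= n -> decode n (f n) (f n.+1).
Proof.
move=> hn; have [_ [c [h1 [h2 [h3 h6]]]]] := f_step n.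
exists c; split=> //; split=> // i iv; case: ltnP => //= ui; case E : (bit _ i) => //=.
by rewrite bit_sz -?(Y_limit hn E) // u_step.
Qed.

(* A wrong code would give a word agreeing with the right one on the part of
   the oracle inside the block, which the code book excludes. *)
Lemma decode_unique n s' : n0 <= n -> decode n (f n) s' -> s' = f n.+1.
Proof.
move=> hn [c [cl [hc hY]]]; have [c0 [cl0 [hc0 hY0]]] := decode_exists hn.
suff cc : c = c0 by rewrite cc in hc; apply: dec_step_fun hc hc0.
have [T [D [hB [_ e1]]]] := hc; have [T' [D' [hB' [_ e1']]]] := hc0.
rewrite (B_fun hB' hB) in e1'; have [en ne] := e_active hn.
have zu : sz (f n) < 2 ^ su (f n) by have [[]] := f_step n.
have agr t t' : (t = sq T c /\ t' = sq T c0) \/ (t = sq T c0 /\ t' = sq T c) ->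
    agree (su (f n)) (sv (f n)) (sq (sD0 (f n)) e).-1 t t'.
  move=> h; apply/ballP => i iv; apply/implyP => /andP[ui ri].
  have := hY i iv; have := hY0 i iv; rewrite ltnNge ui ri /= e1 e1' !stateE.
  rewrite -{1 3}(subnKC ui) !bit_high // => /eqP h1 /eqP h2.
  by case: h => [[-> ->]|[-> ->]]; rewrite h1 h2.
case: (ltngtP c c0) => // lt.
  have [_ /(_ _ lt)/bexP[]] := bookW hB cl0; exists e => //; rewrite ne /=; apply: agr; by left.
have [_ /(_ _ lt)/bexP[]] := bookW hB cl; exists e => //; rewrite ne /=; apply: agr; by right.
Qed.

(** From the state at n0, supplied as a constant, the search can return only the true successors;
    the earlier states form a finite table. *)
Lemma comp_decoded : computable_in Y f.
Proof.
have [||||g [cg g0 hg]] := @CE_sequence Y (fun k s s' => decode (n0 + k) s s')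
    (fun k s => s = f (n0 + k)) (f n0).
- rewrite /decode /sv /su /sz /sD0 /yr; enumerability; apply: CE_dec_step; computability.
- by rewrite addn0.
- by move=> n s ->; exists (f (n0 + n).+1); apply: decode_exists; exact: leq_addr.
- by move=> n s s' -> /decode_unique; rewrite addnS; apply; exact: leq_addr.
by apply: comp_table cg _ => k; case: (hg k) => ->.
Qed.

Lemma decoded_set : turing_le limit_set Y.
Proof. by have cf := comp_decoded; have : decidable_in Y limit_set; rewrite /limit_set /sz; computability. Qed.

Lemma decoded_message : turing_le A Y.
Proof.
have cf := comp_decoded; apply: (@comp_ext _ (fun n => bit (sh (f n.+1)) n : nat)).
  by move=> n; rewrite sh_bit.
by rewrite /sh; computability.
Qed.
End decoder.
End decoding.
End construction.

Definition selector p := forall x, exists2 y, eval natset0 p x y & valid (left x) (right x) y.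

(** Selectors are the sole interface to the construction: their clopen sets give randomness, their
    sets of positions give decoding from any Y that agrees with Z there. *)
Theorem robust_coding (a : set natset) : turing_degree a -> high a ->
  exists A Z : natset, exists u : nat -> nat, [/\ a = deg A,
    forall n, u n < u n.+1, turing_le Z A,
    forall p, selector p -> exists n0, forall n, n0 <= n ->
      exists2 y, eval natset0 p (npair (u n) (u n.+1)) y & ~~ bit (yw y) (pcode Z (yl y)) &
    forall p (Y : natset), selector p ->
      (forall x y i, eval natset0 p x y -> bit (yr y) i -> Y i = Z i) ->
      turing_le Z Y /\ turing_le A Y].
Proof.
move=> da ha; have [A [aA hA]] := high_nontotal da ha.
have [|N CE_N hN] := hA convergent.
  rewrite /convergent; enumerability; first by apply: CE_Ev0; computability.
  by apply: dec_valid; computability.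
have [|B [CE_B B_book B_fun B_ex]] := @CE_unif natset0 is_book.
  rewrite /is_book /sv /su /sz /sD0 /sD1; enumerability; apply: dec_book; computability.
have CE_B' C : enumerable_in C (fun z => B (left z) (right z)) by apply: CE0.
have Np e := proj2 (hN e); have Nt e := proj1 (hN e).
have [f [cf hf]] := enc_sequence CE_N Np CE_B' B_book B_ex.
exists A, (limit_set f), (fun n => su (f n)); split=> //.
- exact: u_lt hf.
- exact: limit_set_le cf.
- move=> p sp; have [|n0 h] := @limit_set_avoids A N Nt B B_book f hf (prog_code p).
    by move=> x; have [y h1 h2] := sp x; exists y; rewrite Ev_prog.
  by exists n0 => n /h[y [/Ev_prog h1 _ h2]]; exists y.
- move=> p Y sp hY.
  have [|n0 h] := @eventually_active A N Nt B f hf (prog_code p).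
    by move=> x; have [y h1 h2] := sp x; exists y; rewrite Ev_prog.
  have h1 n : n0.+1 <= n -> prog_code p < n /\ sq (sD0 (f n)) (prog_code p) != 0.
    by case: n => // n /h[y [en e _ _]]; rewrite (sD0_step hf) e.
  have h2 n i : n0.+1 <= n -> bit (yr (sq (sD0 (f n)) (prog_code p)).-1) i -> Y i = limit_set f i.
    by case: n => // n /h[y [_ e /Ev_prog ev _]]; rewrite (sD0_step hf) e; apply: hY ev.
  split; first exact: (decoded_set CE_B' B_book B_fun hf h1 h2).
  exact: (decoded_message CE_B' B_book B_fun hf h1 h2).
Qed.

(** * Selectors from enumerable sets and from Schnorr tests *)

Lemma rcount_geq L u y :
  bsum L (fun i => (u <= i) && bit (yr y) i) <= rcount u y.
Proof.
rewrite /rcount; case: (leqP L (yr y)) => [|/ltnW] h; first exact: bsum_widen.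
rewrite -(subnKC h) bsum_cat [X in _ + X](eq_bsum (g := fun=> 0)); last first.
  move=> i _; case E : (bit _ _); last by rewrite andbF.
  by have := bit_lt E; lia.
by rewrite bsum_const muln0 addn0.
Qed.

Lemma infinite_count (A : natset) v k : infinite_set [set n | A n] ->
  exists L, k <= bsum L (fun i => (v <= i) && A i).
Proof.
move=> infA; elim: k => [|k [L hL]]; first by exists 0.
suff [i [Ai iv]] : exists i, A i /\ v + L <= i.
  exists i.+1; rewrite bsumS Ai (leq_trans (leq_addr _ _) iv) addn1 ltnS.
  by apply: leq_trans hL _; apply: bsum_widen; apply: leq_trans (leq_addl _ _) iv.
apply: contrapT => h; apply: infA.
apply: (@sub_finite_set _ _ `I_(v + L)); last exact: finite_II.
move=> i /= Ai; rewrite ltnNge; apply/negP => le; apply: h; by exists i.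
Qed.

Lemma rec_enumerable_CE A : rec_enumerable A -> enumerable_in natset0 (fun x => A x).
Proof.
move=> [p hp]; apply: (@CE_ext _ (fun x => exists v, Ev natset0 (prog_code p) x v)).
  by move=> x; rewrite hp; split=> -[v]; rewrite ?Ev_prog => h; exists v; rewrite ?Ev_prog.
by apply: (@CE_ex _ (fun x v => Ev natset0 (prog_code p) x v)); apply: CE_Ev; computability.
Qed.

(** Search for a finite set of numbers confirmed by the enumeration of A, with at least 2v of them
    from v on. Infinity of A makes the search total. *)
Lemma enumerable_selector (A : natset) : rec_enumerable A -> infinite_set [set n | A n] ->
  exists2 p, selector p & forall x y i, eval natset0 p x y -> bit (yr y) i -> A i.
Proof.
move=> reA infA.
have [Q cQ hQ] : exists2 Q : nat -> Prop, enumerable_in natset0 Q & forall x, Q x <-> A x.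
  by exists (fun x => A x) => //; exact: rec_enumerable_CE.
have [|p hp] := @CE_choice_prog natset0 (fun x y => valid (left x) (right x) y /\
   forall i, i < yr y -> ~~ bit (yr y) i \/ Q i).
  by rewrite /yr; enumerability; apply: dec_valid; computability.
have ex x : exists y, valid (left x) (right x) y /\ forall i, i < yr y -> ~~ bit (yr y) i \/ Q i.
  have [L hL] := infinite_count (right x) (2 * right x) infA.
  have [r' r'L hr'] : exists2 r', r' < 2 ^ L & forall i, bit r' i = (i < L) && (right x <= i) && A i.
    have [r' h1 h2] := bits_exist L (fun i => (right x <= i) && A i); exists r' => // i.
    by case: ltnP => h; [rewrite h2|rewrite (bit_small h1)].
  (* The last component 0 is the empty clopen set. *)
  exists (npair r' (npair (right x) 0)); split.
    apply/and3P; split; rewrite /yl ?pairE //.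
    - apply: leq_trans hL _; apply: leq_trans (rcount_geq L _ _).
      by apply: leq_bsum => i iL; rewrite /yr pairE hr' iL; case: (right x <= i).
    - rewrite /wcount /yl /yw !pairE (eq_bsum (g := fun=> 0)) ?bsum_const ?muln0 //.
      by move=> i _; case E : (bit _ _) => //; have := bit_lt E.
  by move=> i _; rewrite /yr pairE hr' hQ; case: (A i); [right|left; rewrite andbF].
have sel x : exists2 y, eval natset0 p x y & valid (left x) (right x) y /\
    forall i, i < yr y -> ~~ bit (yr y) i \/ Q i.
  by have [y h1 h2] := hp x (ex x); exists y.
exists p => [x|x y i ev bi]; first by have [y h1 [h2 _]] := sel x; exists y.
have [y' ev' [_ h]] := sel x; rewrite (eval_fun ev ev') in bi.
by case: (h i (bit_lt bi)) => [|/hQ//]; rewrite bi.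
Qed.

(** * Stages of a Schnorr test and their measures *)

Definition str_drop c i := iter i (fun c => c.-1 %/ 2) c.

(** An exhausted string has code 0; c steps are enough, a string being no longer than its code. *)
Definition str_prefix c s :=
  ball c (fun i => (str_drop c i == 0) || (odd (str_drop c i).-1 == bit s i)).

Lemma dec_str_prefix A f g : computable_in A f -> computable_in A g -> decidable_in A (fun x => str_prefix (f x) (g x)).
Proof.
move=> hf hg; have h f' g' : computable_in A f' -> computable_in A g' -> computable_in A (fun x => str_drop (f' x) (g' x)).
  move=> hf' hg'; apply: (@comp_ext _ (fun x => nat_rect (fun _ => nat) (f' x)
     ((fun x k r => r.-1 %/ 2) x) (g' x))); last by apply: comp_rec; computability.
  by move=> x; rewrite /str_drop; elim: (g' x) => //= k ->.
rewrite /str_prefix; computability; apply: h; computability.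
Qed.

Lemma str_drop_code s i : str_drop (string_code s) i = string_code (drop i s).
Proof.
elim: i s => [|i ih] s; first by rewrite drop0.
rewrite /str_drop iterSr; case: s => [|b s] /=.
  by rewrite div0n -[iter _ _ _]/(str_drop (string_code [::]) i) ih.
have -> : ((string_code s).*2 + b) %/ 2 = string_code s.
  by case: b; lia.
exact: ih.
Qed.

Lemma size_string_code s : size s <= string_code s.
Proof. by elim: s => //= b s ih; rewrite ltnS; case: b; lia. Qed.

Lemma string_code_surj c : exists s, string_code s = c.
Proof.
elim/ltn_ind: c => -[|c] ih; first by exists [::].
have [|s hs] := ih (c %/ 2); first by lia.
by exists (odd c :: s); rewrite /= hs; case: odd (odd_double_half c); lia.
Qed.

Lemma str_prefixP s t : str_prefix (string_code s) t <->
  forall i, i < size s -> nth false s i = bit t i.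
Proof.
have nth_code i : i < size s -> string_code (drop i s) != 0 /\
    odd (string_code (drop i s)).-1 = nth false s i.
  move=> il; rewrite (drop_nth false il) /=; split=> //.
  by rewrite oddD odd_double oddb.
rewrite /str_prefix; split=> [/ballP h i il|h].
  have := h i (leq_trans il (size_string_code s)).
  by rewrite str_drop_code; have [/negbTE -> ->] := nth_code i il; move=> /eqP.
apply/ballP => i _; rewrite str_drop_code.
case: (ltnP i (size s)) => il; last by rewrite drop_oversize.
by have [_ ->] := nth_code i il; rewrite h // eqxx orbT.
Qed.

Local Open Scope classical_set_scope.
Section measure_count.
Import Order.TTheory GRing.Theory Num.Theory.
Variable R : realType.
Local Notation mu := (@uniform_measure R).

Lemma cylinder_measurable s : measurable (cylinder s : set cantorType).
Proof. by apply: sub_sigma_algebra; exists s. Qed.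

Lemma pcode_cylinder l k : k < 2 ^ l ->
  [set X | pcode X l = k] = cylinder (mkseq (bit k) l).
Proof.
move=> kl; apply/seteqP; split=> X /=.
  by move=> <- i; rewrite size_mkseq => il; rewrite nth_mkseq // bit_pcode.
move=> h; apply/esym/pcode_eq => // i il.
by rewrite -h ?size_mkseq // nth_mkseq.
Qed.

(** Induction on n: each value satisfying P adds one disjoint cylinder of measure 2^-l. *)
Lemma measure_pcode_lt l (P : nat -> bool) n : n <= 2 ^ l ->
  measurable ([set X | pcode X l < n /\ P (pcode X l)] : set cantorType) /\
  mu [set X | pcode X l < n /\ P (pcode X l)] = ((bsum n (fun s => P s))%:R / 2 ^+ l)%:E%R.
Proof.
elim: n => [|n ih] nl.
  rewrite (_ : [set _ | _] = set0); last by apply/seteqP; split=> X //= -[].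
  by rewrite measure0 bsum0 mul0r; split.
have [m1 e1] := ih (ltnW nl).
pose C := if P n then cylinder (mkseq (bit n) l) : set cantorType else set0.
have mC : measurable C by rewrite /C; case: (P n) => //; exact: cylinder_measurable.
have -> : [set X | pcode X l < n.+1 /\ P (pcode X l)] =
    [set X | pcode X l < n /\ P (pcode X l)] `|` C.
  rewrite /C -(pcode_cylinder nl); apply/seteqP; split=> X /=.
    rewrite ltnS leq_eqVlt => -[/predU1P[e|lt] PX]; last by left.
    by right; move: PX; rewrite e => ->.
  case=> [[lt PX]|]; first by split=> //; apply: ltnW.
  by case E : (P n) => //= ->.
split; first exact: measurableU.
have -> : mu ([set X | pcode X l < n /\ P (pcode X l)] `|` C) =
    (mu [set X | (pcode X l < n)%N /\ P (pcode X l)] + mu C)%E.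
  apply: measureU => //; apply/seteqP; split=> X //= -[[lt _]].
  by rewrite /C -(pcode_cylinder nl); case: (P n) => //= e; rewrite e ltnn in lt.
have -> : mu C = ((P n : nat)%:R / 2 ^+ l)%:E%R.
  rewrite /C; case: ifP => _; last by rewrite measure0 mul0r.
  by rewrite uniform_measure_cylinder size_mkseq mul1r.
by rewrite e1 bsumS -EFinD natrD mulrDl.
Qed.

Lemma measurable_pcode l (P : nat -> bool) :
  measurable ([set X | P (pcode X l)] : set cantorType).
Proof.
rewrite (_ : [set _ | _] = [set X | pcode X l < 2 ^ l /\ P (pcode X l)]).
  by case: (measure_pcode_lt P (leqnn (2 ^ l))).
apply/seteqP; split=> X /= => [h|[]//].
by split=> //; exact: pcode_lt.
Qed.

Lemma measure_pcode l (P : nat -> bool) :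
  mu [set X | P (pcode X l)] = ((bsum (2 ^ l) (fun s => P s))%:R / 2 ^+ l)%:E%R.
Proof.
rewrite -(proj2 (measure_pcode_lt P (leqnn (2 ^ l)))); congr (mu _).
apply/seteqP; split=> X /= => [h|[]//].
by split=> //; exact: pcode_lt.
Qed.

(** Clopen approximations from within. The last clause says that stages have measure at most 2^-m
    and come within 2^-k of it; here the exact measures of a Schnorr test enter. *)
Lemma schnorr_stages (G : nat -> set natset) : schnorr_test R G ->
  exists In : nat -> nat -> nat -> bool,
  [/\ decidable_in natset0 (fun z => In (left z) (left (right z)) (right (right z))),
      forall m J s t, (forall i, i < J -> bit s i = bit t i) -> In m J s = In m J t,
      forall m J J' s, J <= J' -> In m J s -> In m J' s,
      forall m X, G m X -> exists J, In m J (pcode X J) &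
      forall m, (forall J, bsum (2 ^ J) (fun s => In m J s) * 2 ^ m <= 2 ^ J) /\
        forall k, exists J, 2 ^ (J + k) <=
          bsum (2 ^ J) (fun s => In m J s) * 2 ^ (m + k) + 2 ^ (J + m)].
Proof.
move=> [[p hp] muG].
have [q cq hq] : enumerable_in natset0 (fun x => exists v, eval natset0 p x v).
  apply: (@CE_ext _ (fun x => exists v, Ev natset0 (prog_code p) x v)).
    by move=> x; split=> -[v]; rewrite ?Ev_prog => h; exists v; rewrite ?Ev_prog.
  by apply: (@CE_ex _ (fun x v => Ev natset0 (prog_code p) x v)); apply: CE_Ev; computability.
(* A string with code below J has length below J, so J bits of s decide stage J. *)
pose In m J s := bex J (fun c => str_prefix c s && bex J (fun w => q (npair (npair m c) w) == 0)).
have In_local m J s t : (forall i, i < J -> bit s i = bit t i) -> In m J s -> In m J t.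
  move=> st /bexP[c cJ /andP[/ballP h1 h2]]; apply/bexP; exists c => //; rewrite h2 andbT.
  by apply/ballP => i ic; rewrite -st ?(ltn_trans ic) //; apply: h1.
have In_mono m J J' s : J <= J' -> In m J s -> In m J' s.
  move=> le /bexP[c cJ /andP[h1 /bexP[w wJ h2]]]; apply/bexP; exists c; first exact: leq_trans le.
  by rewrite h1; apply/bexP; exists w => //; exact: leq_trans le.
pose E m J := [set X | In m J (pcode X J)] : set cantorType.
have mE m J : measurable (E m J) by exact: measurable_pcode.
have muE m J : mu (E m J) = ((bsum (2 ^ J) (fun s => In m J s))%:R / 2 ^+ J)%:E%R.
  exact: (measure_pcode J (In m J)).
have cover m : G m = \bigcup_J E m J.
  rewrite hp; apply/seteqP; split=> X [].
    move=> s /= /hq[w hw] sX; exists (maxn (string_code s) w).+1 => //.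
    apply/bexP; exists (string_code s); first by rewrite ltnS leq_maxl.
    apply/andP; split; last first.
      by apply/bexP; exists w; [rewrite ltnS leq_maxr|rewrite hw].
    apply/str_prefixP => i il; rewrite bit_pcode ?sX // ltnS leq_max.
    by rewrite (leq_trans (ltnW il)) // size_string_code.
  move=> J _ /bexP[c cJ /andP[h1 /bexP[w _ /eqP h2]]].
  have [s es] := string_code_surj c; exists s; first by rewrite /= es hq; exists w.
  move=> i il; rewrite -es in h1 cJ; rewrite (proj1 (str_prefixP _ _) h1) // bit_pcode //.
  exact: leq_trans il (leq_trans (size_string_code s) (ltnW cJ)).
have Emono m : nondecreasing_seq (E m).
  move=> J J' JJ; apply/subsetPset => X; rewrite /E /= => h; apply: (In_mono _ _ _ _ JJ).
  by apply: In_local h => i iJ; rewrite !bit_pcode // (leq_trans iJ JJ).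
have mG m : measurable (\bigcup_J E m J) by exact: bigcup_measurable.
exists In; split=> //.
- by rewrite /In; computability; apply: dec_str_prefix; computability.
- by move=> m J s t st; apply/idP/idP; apply: In_local => i iJ; rewrite st.
- by move=> m X; rewrite cover => -[J _ h]; exists J.
move=> m; split=> [J|k].
  have : (mu (E m J) <= mu (G m))%E.
    by rewrite cover; apply: le_measure; rewrite ?inE //; exact: bigcup_sup.
  rewrite muE muG lee_fin ler_pdivrMr ?exprn_gt0 // ler_pdivlMl ?exprn_gt0 //.
  by rewrite -!natrX -natrM ler_nat mulnC.
(* Otherwise every stage has measure at most 2^-m - 2^-k, and by continuity from below so has their
   union [G m]. *)
apply: contrapT => h.
have cvg : (mu \o E m) @ \oo --> mu (\bigcup_J E m J) by exact: nondecreasing_cvg_mu.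
have : (lim ((mu \o E m) @ \oo) <= (2 ^- m - 2 ^- k)%:E)%E.
  apply: lime_le; first by apply/cvg_ex; eexists; exact: cvg.
  apply: nearW => J; rewrite -[X in (X <= _)%E]/(mu (E m J)) muE lee_fin.
  have : ~~ (2 ^ (J + k) <= bsum (2 ^ J) (fun s => In m J s) * 2 ^ (m + k) + 2 ^ (J + m))%N.
    by apply/negP => le; apply: h; exists J.
  rewrite -ltnNge => /ltnW; set b := bsum _ _ => le.
  rewrite ler_pdivrMr ?exprn_gt0 // mulrBl -(ler_nat R) in le *.
  rewrite natrD natrM !natrX !exprD in le.
  have m0 : (0 < 2 ^+ m :> R)%R by rewrite exprn_gt0.
  have k0 : (0 < 2 ^+ k :> R)%R by rewrite exprn_gt0.
  rewrite lerBrDr -(ler_pM2r (mulr_gt0 m0 k0)).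
  apply: le_trans (_ : _ <= b%:R * (2 ^+ m * 2 ^+ k) + 2 ^+ J * 2 ^+ m)%R _.
    by rewrite mulrDl lerD2l [(_ * 2 ^+ J)%R]mulrC -mulrA [(2 ^- k * _)%R]mulrC -mulrA divff ?mulr1 // gt_eqF.
  apply: le_trans le _.
  by rewrite [(2 ^- m * _)%R]mulrC -mulrA [(2 ^- m * _)%R]mulrA mulVf ?mul1r // gt_eqF.
rewrite (cvg_lim _ cvg) // -cover muG lee_fin lerBrDr gerDl leNgt.
by rewrite invr_gt0 exprn_gt0.
Qed.
End measure_count.

(** The induction carries the sharper bound N (1 - 2^-n). *)
Lemma bsum_geometric n N (c : nat -> nat) : (forall i, i < n -> c i * 2 ^ i.+1 <= N) ->
  bsum n c <= N.
Proof.
move=> h; suff : bsum n c * 2 ^ n <= N * (2 ^ n - 1).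
  move=> le; rewrite -(@leq_pmul2r (2 ^ n)) ?expn_gt0 //; apply: leq_trans le _.
  by rewrite leq_mul2l leq_subr orbT.
elim: n h => [|n ih] h; first by rewrite bsum0 mul0n.
have h1 := ih (fun i lt => h i (ltnW lt)); have := h n (ltnSn n).
rewrite bsumS expnS; have : 0 < 2 ^ n by rewrite expn_gt0.
move: (bsum n c) (c n) (2 ^ n) h1 => a b k.
rewrite !mulnBr !muln1 => h1 k0 h2.
have : N <= N * k by rewrite leq_pmulr.
by rewrite mulnDl; lia.
Qed.

(** * The selector of a Schnorr test *)

Section schnorr_selector.
Variable In : nat -> nat -> nat -> bool.
Hypothesis dec_In : decidable_in natset0 (fun z => In (left z) (left (right z)) (right (right z))).
Hypothesis In_local : forall m J s t, (forall i, i < J -> bit s i = bit t i) -> In m J s = In m J t.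
Hypothesis In_mono : forall m J J' s, J <= J' -> In m J s -> In m J' s.
Hypothesis In_bound : forall m J, bsum (2 ^ J) (fun s => In m J s) * 2 ^ m <= 2 ^ J.
Hypothesis In_approx : forall m k, exists J, 2 ^ (J + k) <=
  bsum (2 ^ J) (fun s => In m J s) * 2 ^ (m + k) + 2 ^ (J + m).

Let cnt m J l := bsum (2 ^ l) (fun s => In m J s).

Lemma cnt_scale m J l : J <= l -> cnt m J l = 2 ^ (l - J) * cnt m J J.
Proof.
move=> Jl; rewrite /cnt -{1}(subnKC Jl) expnD bsum_mul -bsum_const.
apply: eq_bsum => t _; apply: eq_bsum => s _; congr nat_of_bool.
by apply: In_local => i iJ; rewrite bit_low.
Qed.

Lemma cnt_approx m k J l : J <= l ->
  2 ^ (J + k) <= cnt m J J * 2 ^ (m + k) + 2 ^ (J + m) ->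
  2 ^ (l + k) <= cnt m J l * 2 ^ (m + k) + 2 ^ (l + m).
Proof.
move=> Jl h; have e a : 2 ^ (l + a) = 2 ^ (l - J) * 2 ^ (J + a).
  by rewrite -expnD addnA subnK.
by rewrite cnt_scale // !e -mulnA -mulnDr leq_mul2l h orbT.
Qed.

Lemma cnt_mono m J J' l : J <= J' -> cnt m J l <= cnt m J' l.
Proof.
move=> le; apply: leq_bsum => s _; case E : (In m J s) => //.
by rewrite (In_mono le E).
Qed.

(* Chosen so that the part of [novel u v] due to m has measure at most
   2^-(3 u + m + 1), both for m <= u and for u < m. *)
Let level m := 4 * m + 1.

(** After division by powers of 2: for each m <= x, stage J of the component [level m] lacks at most
    2^-(level x) of its measure. *)
Definition stage_ok x J := x <= J /\ forall m, m < x.+1 ->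
  2 ^ (J + level x) <= cnt (level m) J J * 2 ^ (level m + level x) + 2 ^ (J + level m).

Lemma dec_In_comp f g h : computable_in natset0 f -> computable_in natset0 g -> computable_in natset0 h ->
  decidable_in natset0 (fun x => In (f x) (g x) (h x)).
Proof.
move=> hf hg hh; apply: dec_ext (dec_comp (f := fun x => npair (f x) (npair (g x) (h x))) dec_In _).
  by move=> x; rewrite !pairE.
by computability.
Qed.

Lemma stage_exists : exists2 J, computable_in natset0 J & forall x, stage_ok x (J x).
Proof.
apply: CE_choice => [|x].
  rewrite /stage_ok /level /cnt; enumerability; apply: dec_In_comp; computability.
have /choice[g hg] := fun m => In_approx (level m) (level x).
exists (x + bsum x.+1 g); split=> [|m mx]; first exact: leq_addr.
have gl : g m <= x + bsum x.+1 g by apply: leq_trans (bsum_geq _ mx) (leq_addl _ _).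
apply: leq_trans (cnt_approx gl (hg m)) _; rewrite leq_add2r leq_mul2r.
by rewrite (cnt_mono _ _ gl) orbT.
Qed.

Variable J : nat -> nat.
Hypothesis comp_J : computable_in natset0 J.
Hypothesis J_ok : forall x, stage_ok x (J x).

(* What the stages at v add, for the components m <= v, to the stages at u. *)
Definition novel u v s := bex v.+1 (fun m => In (level m) (J v) s &&
  ((u < m) || ~~ In (level m) (J u) s)).

(** For u < m the whole component is small. For m <= u, the new part and the stage at u are disjoint
    inside a set of measure at most 2^-(level m), of which the latter lacks at most 2^-(level u). *)
Lemma novel_count u v l : J u <= l -> J v <= l ->
  bsum (2 ^ l) (fun s => novel u v s) * 2 ^ (3 * u) <= 2 ^ l.
Proof.
move=> ul vl; pose c m := bsum (2 ^ l) (fun s => In (level m) (J v) s &&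
  ((u < m) || ~~ In (level m) (J u) s)).
have bnd m : cnt (level m) l l * 2 ^ level m <= 2 ^ l by exact: In_bound.
have hc m : c m * 2 ^ (3 * u + m.+1) <= 2 ^ l.
  have le_exp a b n : a <= b -> n * 2 ^ b <= 2 ^ l -> n * 2 ^ a <= 2 ^ l.
    by move=> ab; apply: leq_trans; rewrite leq_mul2l leq_exp2l // ab orbT.
  case: (ltnP u m) => um.
    apply: (@le_exp _ (level m)); first by rewrite /level; lia.
    apply: leq_trans (bnd m); rewrite leq_mul2r; apply/orP; right.
    apply: leq_trans (cnt_mono _ _ vl); rewrite /c um; apply: leq_bsum => s _.
    by rewrite andbT.
  apply: (@le_exp _ (level u)); first by rewrite /level; lia.
  have h1 : c m + cnt (level m) (J u) l <= cnt (level m) l l.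
    rewrite /c /cnt -bsumD ltnNge um; apply: leq_bsum => s _ /=.
    case E : (In _ (J u) s); first by rewrite andbF (In_mono ul E).
    by case F : (In _ (J v) s); rewrite //= (In_mono vl F).
  have h2 : 2 ^ (l + level u) <= cnt (level m) (J u) l * 2 ^ (level m + level u) + 2 ^ (l + level m).
    by apply: cnt_approx => //; apply: (proj2 (J_ok u)).
  rewrite -(@leq_pmul2r (2 ^ level m)) ?expn_gt0 //.
  have := leq_mul (leq_mul h1 (leqnn (2 ^ level m))) (leqnn (2 ^ level u)).
  have := leq_mul (bnd m) (leqnn (2 ^ level u)).
  move: h2; rewrite !expnD; move: (2 ^ level m) (2 ^ level u) (2 ^ l) (c m) => a b d e.
  by move: (cnt _ (J u) l) (cnt _ l l) => p q; lia.
apply: (@leq_trans (bsum v.+1 c * 2 ^ (3 * u))).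
  rewrite leq_mul2r; apply/orP; right; rewrite /c bsum_exchange; apply: leq_bsum => s _.
  exact: (bex_bsum v.+1 (fun m => In (level m) (J v) s && ((u < m) || ~~ In (level m) (J u) s))).
rewrite mulnC bsum_distr; apply: bsum_geometric => m _.
by rewrite -mulnA mulnCA -expnD.
Qed.

Lemma dec_novel f g h : computable_in natset0 f -> computable_in natset0 g -> computable_in natset0 h ->
  decidable_in natset0 (fun x => novel (f x) (g x) (h x)).
Proof.
by move=> hf hg hh; rewrite /novel /level; computability; apply: dec_In_comp; computability.
Qed.

Lemma novel_selector : exists2 p, selector p &
  forall u v y s, eval natset0 p (npair u v) y -> s < 2 ^ yl y ->
    yl y = J u + J v /\ bit (yw y) s = novel u v s.
Proof.
pose P x y := valid (left x) (right x) y /\ yl y = J (left x) + J (right x) /\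
  forall s, s < 2 ^ yl y -> bit (yw y) s == novel (left x) (right x) s.
have [|p hp] := @CE_choice_prog natset0 P.
  rewrite /P /yl /yw; enumerability; first by apply: dec_valid; computability.
  by apply: dec_novel; computability.
have ex x : exists y, P x y.
  set u := left x; set v := right x.
  (* Only the clopen set matters here; all numbers below 3v provide the 2v positions from v on. *)
  have [r r3 hr] := bits_exist (3 * v) (fun=> true).
  have [w _ hw] := bits_exist (2 ^ (J u + J v)) (novel u v).
  exists (npair r (npair (J u + J v) w)); rewrite /P /yl /yw !pairE; split; last first.
    by split=> // s sl; rewrite hw.
  apply/and3P; rewrite /wcount /yl /yw !pairE; split.
  - by apply: leq_trans (leq_addl _ _); case: (J_ok v).
  - apply: leq_trans (rcount_geq (3 * v) _ _); rewrite /yr pairE.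
    rewrite (_ : 3 * v = v + 2 * v); last by lia.
    rewrite (bsum_cat v (2 * v)).
    apply: leq_trans (leq_addl _ _); rewrite -[leqLHS]muln1 -bsum_const.
    by apply: leq_bsum => i i2; rewrite leq_addr hr //; lia.
  - rewrite (eq_bsum (g := fun s => novel u v s)); first by apply: novel_count; lia.
    by move=> s sl; rewrite hw.
have sel x : exists2 y, P x y & eval natset0 p x y by apply: hp; exact: ex.
exists p => [x|u v y s ev sl]; first by have [y [h1 _] h2] := sel x; exists y.
have [y' [_ [h1 h2]] ev'] := sel (npair u v); rewrite -(eval_fun ev ev') !pairE in h1 h2.
by split=> //; apply/eqP; apply: h2.
Qed.

(** Follow the component m = u n0.+1 until a stage contains Z. If the first stage examined already
    does, the disjunct [u < m] in [novel] counts it as new. *)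
Lemma covered_novel (Z : natset) (u : nat -> nat) n0 : (forall n, u n < u n.+1) ->
  (forall m, exists K, In m K (pcode Z K)) ->
  exists2 n, n0 <= n & forall l, l = J (u n) + J (u n.+1) -> novel (u n) (u n.+1) (pcode Z l).
Proof.
move=> u_lt cov; set m := u n0.+1.
have loc K l : K <= l -> In (level m) K (pcode Z l) = In (level m) K (pcode Z K).
  by move=> Kl; apply: In_local => i iK; rewrite !bit_pcode // (leq_trans iK).
have uge n : n <= u n by elim: n => // n ih; apply: leq_ltn_trans ih (u_lt n).
have umono a b : a <= b -> u a <= u b.
  by move=> /subnKC <-; elim: (b - a) => [|k ih]; rewrite ?addn0 // addnS (leq_trans ih) // ltnW.
pose P n := (n0 < n) && In (level m) (J (u n)) (pcode Z (J (u n))).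
have exP : exists n, P n.
  have [K hK] := cov (level m); exists (maxn n0.+1 K); rewrite /P leq_maxl /=.
  have KJ : K <= J (u (maxn n0.+1 K)).
    apply: leq_trans (leq_maxr n0.+1 K) _; apply: leq_trans (uge _) _.
    by case: (J_ok (u (maxn n0.+1 K))).
  by apply: (In_mono KJ); rewrite (loc _ _ KJ).
case: (ex_minnP exP) => -[//|n] /andP[n0n Pn] hmin; exists n => // l ->.
apply/bexP; exists m; first by rewrite ltnS; apply: umono.
rewrite !loc ?leq_addl ?leq_addr // Pn /=; case: (ltnP (u n) m) => //= le.
apply/negP => h; suff : n.+1 <= n by rewrite ltnn.
apply: hmin; rewrite /P h andbT; rewrite ltnNge; apply/negP => nn0.
have : u n0.+1 <= u n by [].
by rewrite leqNgt (leq_trans (u_lt n)) // umono.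
Qed.
End schnorr_selector.

Lemma schnorr_random_of_selectors (R : realType) (Z : natset) (u : nat -> nat) :
  (forall n, u n < u n.+1) ->
  (forall p, selector p -> exists n0, forall n, n0 <= n ->
      exists2 y, eval natset0 p (npair (u n) (u n.+1)) y & ~~ bit (yw y) (pcode Z (yl y))) ->
  schnorr_random R Z.
Proof.
move=> u_lt hZ G test GZ.
have [In [dIn loc mono cov bnd]] := schnorr_stages test.
have [||||J cJ hJ] := @stage_exists In; rewrite //.
- by move=> m k; case: (bnd m) => _; apply.
have [||||||p sp hp] := @novel_selector In _ _ _ _ J; rewrite //.
- by move=> m K; case: (bnd m).
have [n0 h] := hZ p sp.
have [||||n n0n hn] := @covered_novel In _ _ J _ Z u n0 u_lt; rewrite //.
  by move=> m; apply: cov; apply: GZ.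
have [y ev] := h n n0n; have [e1 e2] := hp _ _ _ _ ev (pcode_lt Z (yl y)).
by rewrite e2 hn.
Qed.

Theorem mainTheorem10 (R : realType) (a : set natset)
    (a_degree : turing_degree a) (a_high : high a) :
  exists Z : natset,
    [/\ a Z,
        schnorr_random R Z,
        forall A : natset, rec_enumerable A -> infinite_set [set n | A n] ->
          turing_le Z (natsetI A Z)
      & forall A : natset, recursive A -> infinite_set [set n | A n] ->
          turing_equiv Z (natsetI A Z)].
Proof.
have [B [Z [u [aB u_lt ZB avoid decode]]]] := robust_coding a_degree a_high.
have coded A : rec_enumerable A -> infinite_set [set n | A n] -> turing_le Z (natsetI A Z).
  move=> reA infA; have [p sp hp] := enumerable_selector reA infA.
  have [|h _] := decode p (natsetI A Z) sp; last exact: h.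
  by move=> x y i ev bi; rewrite /natsetI (hp _ _ _ ev bi).
exists Z; split=> //.
- rewrite aB; split=> //.
  (* With all numbers as the enumerable set, decoding from Z itself recovers B, so Z has degree
     a. *)
  have [||p sp _] := @enumerable_selector (fun=> true).
  + by exists PZero => n; split=> // _; exists 0; constructor.
  + by rewrite (_ : [set _ | _] = setT); [exact: infinite_nat|exact/seteqP].
  + by have [|_ h] := decode p Z sp; last exact: h.
- exact: schnorr_random_of_selectors u_lt avoid.
- move=> A recA infA; split; last first.
    have [p hp] := recA; have hA : decidable_in natset0 A by exists p.
    by have : decidable_in Z (natsetI A Z) by rewrite /natsetI; have hA' := comp0 Z hA; computability.
  apply: coded => //; have [p hp] := recA.
  have [|p' hp'] := @CE_domain natset0 (fun n => A n).
    by have hA : decidable_in natset0 A by [exists p]; enumerability.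
  by exists p'.
Qed.
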